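(* There exists a holomorphic function $f$ on $\mathbb{D}=\{z\in\mathbb{C}:|z|<1\}$ with $f(0)=0$, $f'(0)=1$ and $\operatorname{Re} f'(z)>0$ for all $z\in\mathbb{D}$ (that is, $f\in\mathcal{R}$) such that the boundary $\partial f(\mathbb{D})$, taken in the Riemann sphere $\widehat{\mathbb{C}}$, is not locally connected.
   Context: $\mathcal{R}$ is the Noshiro--Warschawski class of holomorphic functions $f$ on $\mathbb{D}$ with $f(0)=0$, $f'(0)=1$ and $\operatorname{Re} f'(z)>0$ for all $z\in\mathbb{D}$. The boundary of a plane domain is taken in the Riemann sphere $\widehat{\mathbb{C}}$, with the topology of the spherical metric. *)

(* Defs.v *)
(* MathComp-Analysis, with the complex numbers R[i] of mathcomp-real-closed. *)
From HB Require Import structures.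
From mathcomp Require Import all_boot all_order all_algebra.
From mathcomp Require Import complex.
From mathcomp Require Import all_classical all_reals all_analysis.
From mathcomp Require Import ring.

Set Implicit Arguments.
Unset Strict Implicit.
Unset Printing Implicit Defensive.

Import Order.TTheory GRing.Theory Num.Theory numFieldNormedType.Exports.

Local Open Scope classical_set_scope.
Local Open Scope ring_scope.
Local Open Scope complex_scope.

(* The usual topology of R[i], as a normed space over itself; [derivable f z 1]
   and [f^`()] are then complex differentiability and the complex derivative. *)
HB.instance Definition _ (R : rcfType) := NormedModule.copy R[i] R[i]^o.

Definition unit_disk (R : realType) : set R[i] := [set z | `|z| < 1].

Definition holomorphic_on (R : realType) (D : set R[i]) (f : R[i] -> R[i]) :=
  forall z, D z -> derivable f z 1.

Definition noshiro_warschawski (R : realType) (f : R[i] -> R[i]) :=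
  [/\ holomorphic_on (@unit_disk R) f, f 0 = 0, f^`()%classic 0 = 1 &
      forall z, unit_disk z -> 0 < complex.Re (f^`()%classic z)].

(* [None] is the point at infinity. *)
Definition riemann_sphere (R : realType) : Type := option R[i].

Definition to_sphere (R : realType) (z : R[i]) : riemann_sphere R := Some z.

(* The (chordal) spherical metric: the Euclidean distance between the
   stereographic projections to the unit sphere. *)
Definition sphere_dist (R : realType) (p q : riemann_sphere R) : R :=
  match p, q with
  | Some z, Some w =>
      2 * Normc.normc (z - w) /
      (Num.sqrt (1 + Normc.normc z ^+ 2) * Num.sqrt (1 + Normc.normc w ^+ 2))
  | Some z, None | None, Some z => 2 / Num.sqrt (1 + Normc.normc z ^+ 2)
  | None, None => 0
  end.

Section sphere_metric.
Variable R : realType.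
Implicit Types (p q u : riemann_sphere R) (a b c d e f : R[i]).
Import Normc.
#[local] Arguments normc : simpl never.

(* Homogeneous coordinates, used to treat finite points and infinity alike. *)
Let h1 p : R[i] := if p is Some z then z else 1.
Let h2 p : R[i] := if p is Some _ then 1 else 0.
Let N a b : R := Num.sqrt (normc a ^+ 2 + normc b ^+ 2).

Let normc_sqr a : normc a ^+ 2 = complex.Re a ^+ 2 + complex.Im a ^+ 2.
Proof. by case: a => x y; rewrite /normc/= sqr_sqrtr// addr_ge0// sqr_ge0. Qed.

Let normc_ge0 a : 0 <= normc a.
Proof. by case: a => x y; rewrite /normc sqrtr_ge0. Qed.

Let N_gt0 p : 0 < N (h1 p) (h2 p).
Proof.
rewrite sqrtr_gt0; case: p => [z|] /=.
  by rewrite ltr_wpDl ?sqr_ge0// normc1 expr1n.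
by rewrite normc1 normc0 expr1n expr0n addr0.
Qed.

Let sphere_distE p q : sphere_dist p q =
  2 * normc (h1 p * h2 q - h2 p * h1 q) /
  (N (h1 p) (h2 p) * N (h1 q) (h2 q)).
Proof.
rewrite /N; case: p q => [z|] [w|] /=.
- by rewrite normc1 expr1n mulr1 mul1r !(addrC _ 1).
- rewrite mulr0 mul1r sub0r normcN normc0 normc1 !expr1n expr0n addr0 sqrtr1.
  by rewrite !mulr1 (addrC _ 1).
- rewrite mul1r mul0r subr0 normc0 normc1 !expr1n expr0n addr0 sqrtr1.
  by rewrite mulr1 mul1r (addrC _ 1).
- by rewrite mul1r mul0r subrr normc0 mulr0 mul0r.
Qed.

Let cauchy_schwarz c d e f : normc (e^* * c + f^* * d) <= N e f * N c d.
Proof.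
rewrite /N -sqrtrM ?addr_ge0 ?sqr_ge0//.
rewrite -(@ger0_norm _ (normc _)) ?normc_ge0// -sqrtr_sqr ler_wsqrtr//.
have -> : (normc e ^+ 2 + normc f ^+ 2) * (normc c ^+ 2 + normc d ^+ 2) =
    normc (e^* * c + f^* * d) ^+ 2 + normc (e * d - f * c) ^+ 2.
  rewrite !normc_sqr; case: c d e f => [? ?] [? ?] [? ?] [? ?] /=.
  by simpc => /=; ring.
by rewrite lerDl sqr_ge0.
Qed.

Let sphere_distxx p : sphere_dist p p = 0.
Proof. by rewrite sphere_distE [h2 p * _]mulrC subrr normc0 mulr0 mul0r. Qed.

Let sphere_dist_eq0 p q : sphere_dist p q = 0 -> p = q.
Proof.
rewrite sphere_distE => /eqP; rewrite mulf_eq0 invr_eq0 !mulf_eq0.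
rewrite !(gt_eqF (N_gt0 _)) pnatr_eq0 !orbF /= => /eqP/eq0_normc.
case: p q => [z|] [w|] //=; rewrite ?(mulr0, mul0r, mulr1, mul1r) => /eqP.
- by rewrite subr_eq0 => /eqP ->.
- by rewrite sub0r oppr_eq0 oner_eq0.
- by rewrite subr0 oner_eq0.
Qed.

Let sphere_dist_sym p q : sphere_dist p q = sphere_dist q p.
Proof.
rewrite !sphere_distE -normcN opprB [h2 p * _]mulrC [h1 p * _]mulrC.
by rewrite [N (h1 p) _ * _]mulrC.
Qed.

Let sphere_dist_triangle u p q :
  sphere_dist p q <= sphere_dist p u + sphere_dist u q.
Proof.
rewrite !sphere_distE.
have := N_gt0 p; have := N_gt0 q; have := N_gt0 u.
move: (h1 p) (h2 p) (h1 q) (h2 q) (h1 u) (h2 u) => a b c d e f Nu Nq Np.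
have key : normc (a * d - b * c) * N e f ^+ 2 <=
    normc (a * f - b * e) * (N e f * N c d) +
    normc (e * d - f * c) * (N e f * N a b).
  have NE : N e f ^+ 2 = normc (e * e^* + f * f^*).
    rewrite sqr_sqrtr ?addr_ge0 ?sqr_ge0// !normc_sqr.
    case: e f {Nu} => [x y] [v w] /=; simpc => /=.
    rewrite (_ : - (x * y) + y * x + (- (v * w) + w * v) = 0); last by ring.
    rewrite /normc expr0n addr0 sqrtr_sqr -!expr2 ger0_norm//.
    by rewrite !addr_ge0 ?sqr_ge0.
  rewrite NE -normcM.
  rewrite (_ : _ * (_ + _) = (a * f - b * e) * (e^* * c + f^* * d) +
      (e * d - f * c) * (e^* * a + f^* * b)); last by ring.
  rewrite (le_trans (le_normcD _ _))// !normcM.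
  by rewrite lerD// ler_wpM2l ?normc_ge0 ?cauchy_schwarz.
have P0 : 0 < N a b * N c d * N e f ^+ 2 by rewrite !mulr_gt0// exprn_gt0.
rewrite -(ler_pM2r P0) [leRHS]mulrDl.
have -> : 2 * normc (a * d - b * c) / (N a b * N c d) *
    (N a b * N c d * N e f ^+ 2) = 2 * (normc (a * d - b * c) * N e f ^+ 2).
  by field; rewrite !gt_eqF.
have -> : 2 * normc (a * f - b * e) / (N a b * N e f) *
    (N a b * N c d * N e f ^+ 2) =
    2 * (normc (a * f - b * e) * (N e f * N c d)).
  by field; rewrite !gt_eqF.
have -> : 2 * normc (e * d - f * c) / (N e f * N c d) *
    (N a b * N c d * N e f ^+ 2) =
    2 * (normc (e * d - f * c) * (N e f * N a b)).
  by field; rewrite !gt_eqF.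
by rewrite -mulrDr ler_pM2l.
Qed.

HB.instance Definition _ := Choice.on (riemann_sphere R).
HB.instance Definition _ := @isMetric.Build R (riemann_sphere R)
  (@sphere_dist R) sphere_distxx sphere_dist_eq0 sphere_dist_sym
  sphere_dist_triangle.

End sphere_metric.

Definition boundary (T : topologicalType) (A : set T) : set T :=
  closure A `\` A°.

(* Local connectedness of A in its subspace topology: every point of A has a
   base of connected relatively open neighbourhoods [A `&` V]. *)
Definition locally_connected (T : topologicalType) (A : set T) :=
  forall x, A x -> forall U, nbhs x U ->
    exists V, [/\ open V, V x, connected (A `&` V) & A `&` V `<=` U].

(* Main.v *)
Require Import Defs.
From mathcomp Require Import all_boot all_order all_algebra.
From mathcomp Require Import complex.
From mathcomp Require Import all_classical all_reals all_analysis.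
From mathcomp Require Import ring lra.

(* If [Re f' > 0] on the disk, then [Re ((f z - f w) (z - w)^* ) > 0] for all
   [z <> w]. Passing to the limit at a boundary point [v] where [f] is radially
   bounded, with cluster value [b], gives [Re ((f z - b) (z - v)^* ) >= 0], so
   that the ray [b + v t], [t > 0], misses the image. Moreover the image of the
   radius in the direction [u] is a graph over the axis spanned by [u].

   Take [f' z = sum_n c_n / (1 - w_n^* z)] with poles [w_n] on the circle
   tending to [1], points [v_n] of the circle between consecutive poles, and
   [c_n] so small that [f] is bounded on all radii ending at the [v_n]. The
   image of the radius ending at [w_n] runs to infinity, squeezed between a ray
   in direction [v_n] and a limit ray [a + t], [t > 0]. Hence every point of the
   limit ray far enough from [a] is a boundary point of the image, and these
   graphs cut it off from boundary points arbitrarily close to it. *)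

Set Implicit Arguments.
Unset Strict Implicit.
Unset Printing Implicit Defensive.

Import Order.TTheory GRing.Theory Num.Theory numFieldNormedType.Exports.

Local Open Scope classical_set_scope.
Local Open Scope ring_scope.
Local Open Scope complex_scope.

Local Notation nrm := (@Normc.normc _).
Local Notation re := (@complex.Re _).
Local Notation im := (@complex.Im _).

(** * Moduli, real and imaginary parts, and neighbourhoods in the complex plane *)

Section ComplexPlane.
Variable R : realType.
Implicit Types (z w h : R[i]) (x y : R).

Lemma normrCE z : `|z| = (nrm z)%:C.
Proof. by []. Qed.

Lemma nrmE z : nrm z = Num.sqrt (re z ^+ 2 + im z ^+ 2).
Proof. by case: z. Qed.

Lemma nrm_sqr z : nrm z ^+ 2 = re z ^+ 2 + im z ^+ 2.
Proof. by rewrite nrmE sqr_sqrtr// addr_ge0// sqr_ge0. Qed.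

Lemma nrm_ge0 z : 0 <= nrm z.
Proof. by rewrite nrmE sqrtr_ge0. Qed.

Lemma nrm_eq0 z : (nrm z == 0) = (z == 0).
Proof. by apply/eqP/eqP => [/Normc.eq0_normc //|->]; exact: Normc.normc0. Qed.

Lemma nrm_gt0 z : (0 < nrm z) = (z != 0).
Proof. by rewrite lt_neqAle nrm_ge0 andbT eq_sym nrm_eq0. Qed.

Lemma nrmB z w : nrm (z - w) = nrm (w - z).
Proof. by rewrite -normcN opprB. Qed.

Lemma ler_nrmD z w : nrm (z + w) <= nrm z + nrm w.
Proof. exact: le_normcD. Qed.

Lemma ler_nrmB z w : nrm (z - w) <= nrm z + nrm w.
Proof. by rewrite (le_trans (ler_nrmD _ _))// normcN. Qed.

Lemma ler_nrm_dist z w : nrm z <= nrm w + nrm (z - w).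
Proof. by rewrite -{1}(subrK w z) addrC ler_nrmD. Qed.

Lemma nrmX z n : nrm (z ^+ n) = nrm z ^+ n.
Proof.
by elim: n => [|n IH]; rewrite ?expr0 ?Normc.normc1// !exprS Normc.normcM IH.
Qed.

Lemma nrm_real x : nrm x%:C = `|x|.
Proof. by rewrite nrmE /= expr0n addr0 sqrtr_sqr. Qed.

Lemma complex_nat n : n%:R = (n%:R)%:C :> R[i].
Proof. by rewrite rmorph_nat. Qed.

Lemma nrm_nat n : nrm (n%:R : R[i]) = n%:R.
Proof. by rewrite complex_nat nrm_real normr_nat. Qed.

Lemma nrm_conj z : nrm (conjc z) = nrm z.
Proof. by rewrite !nrmE; case: z => a b /=; rewrite sqrrN. Qed.

Lemma ler_re_nrm z : `|re z| <= nrm z.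
Proof. by rewrite nrmE -sqrtr_sqr ler_wsqrtr// lerDl sqr_ge0. Qed.

Lemma ler_im_nrm z : `|im z| <= nrm z.
Proof. by rewrite nrmE -sqrtr_sqr ler_wsqrtr// lerDr sqr_ge0. Qed.

Lemma re_le_nrm z : re z <= nrm z.
Proof. exact: le_trans (ler_norm _) (ler_re_nrm z). Qed.

Lemma ler_nrm_reim z : nrm z <= `|re z| + `|im z|.
Proof.
rewrite -(@ler_pXn2r _ 2)// ?nnegrE ?nrm_ge0 ?addr_ge0// nrm_sqr.
by rewrite sqrrD !real_normK ?num_real//;
  rewrite -addrA lerD2l lerDr mulrn_wge0// mulr_ge0.
Qed.

Lemma reM z w : re (z * w) = re z * re w - im z * im w.
Proof. by case: z w => [? ?] [? ?]. Qed.

Lemma imM z w : im (z * w) = re z * im w + im z * re w.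
Proof. by case: z w => [? ?] [? ?]. Qed.

Lemma reD z w : re (z + w) = re z + re w.
Proof. by case: z w => [? ?] [? ?]. Qed.

Lemma imD z w : im (z + w) = im z + im w.
Proof. by case: z w => [? ?] [? ?]. Qed.

Lemma reN z : re (- z) = - re z.
Proof. by case: z. Qed.

Lemma imN z : im (- z) = - im z.
Proof. by case: z. Qed.

Lemma reB z w : re (z - w) = re z - re w.
Proof. by rewrite reD reN. Qed.

Lemma imB z w : im (z - w) = im z - im w.
Proof. by rewrite imD imN. Qed.

Definition reimE := (reM, imM, reB, imB, reD, imD, reN, imN).

Lemma mul_conj z : z * conjc z = (nrm z ^+ 2)%:C.
Proof.
by rewrite nrm_sqr; case: z => a b /=; simpc; congr (_ +i* _); ring.
Qed.

Lemma complex_ext z w : re z = re w -> im z = im w -> z = w.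
Proof. by case: z w => [? ?] [? ?] /= -> ->. Qed.

Lemma conjcM z w : conjc (z * w) = conjc z * conjc w.
Proof. by case: z w => [a b] [c d]; apply: complex_ext => /=; ring. Qed.

Lemma conjc_sub1 z : conjc (z - 1) = conjc z - 1.
Proof.
by case: z => a b; apply: complex_ext; rewrite /= ?oppr0 ?subr0 ?addr0.
Qed.

Lemma conjc_scale x z : conjc (x%:C * z) = x%:C * conjc z.
Proof. by case: z => a b; apply: complex_ext => /=; ring. Qed.

Lemma nbhs_complexP z (U : set R[i]) :
  nbhs z U <-> exists2 e, 0 < e & forall w, nrm (w - z) < e -> U w.
Proof.
split.
  move=> /nbhs_ballP[[e1 e2]] /= e0 eU.
  move: e0; rewrite ltcE /= => /andP[/eqP e20 e10]; exists e1 => // w we.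
  apply: eU; rewrite /ball /= normrCE ltcE /= -e20 eqxx /=.
  by rewrite nrmB.
move=> [e e0 eU]; apply/nbhs_ballP; exists e%:C => /=; first by rewrite ltcR.
by move=> w; rewrite /ball /= normrCE ltcR => we; apply: eU; rewrite nrmB.
Qed.

Lemma open_complexP (U : set R[i]) : open U <->
  forall z, U z -> exists2 e, 0 < e & forall w, nrm (w - z) < e -> U w.
Proof.
by rewrite openE; split=> [Uo z /Uo/nbhs_complexP//|Uo z /Uo /nbhs_complexP].
Qed.

Lemma cvg_complexP (T : Type) (F : set_system T) (FF : Filter F)
    (f : T -> R[i]) z :
  f @ F --> z <-> forall e, 0 < e -> \forall t \near F, nrm (f t - z) < e.
Proof.
split=> [fz e e0|fz U /nbhs_complexP[e e0 eU]].
  by apply: (fz [set w | nrm (w - z) < e]); apply/nbhs_complexP; exists e.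
by apply: filterS (fz e e0) => t; exact: eU.
Qed.

Lemma unit_diskE z : unit_disk z = (nrm z < 1) :> Prop.
Proof. by rewrite /unit_disk /= normrCE -[1]/(1%:C) ltcR. Qed.

End ComplexPlane.

(** * Differentiation with a quadratic remainder and the mean value theorem *)

Section QuadraticDerivative.
Variable R : realType.
Implicit Types (f F : R[i] -> R[i]) (z d v w h : R[i]).

(* First-order Taylor estimate with quadratic remainder: it sums termwise, and
   it yields both complex derivatives and real ones along segments. *)
Definition qderiv f z d := exists2 C, 0 <= C & exists2 e : R, 0 < e &
  forall h, nrm h < e -> nrm (f (z + h) - f z - d * h) <= C * nrm h ^+ 2.

Lemma qderiv_continuous f z d : qderiv f z d -> f @ z --> f z.
Proof.
move=> [C C0 [e e0 He]]; apply/(cvg_complexP (nbhs_filter z)) => eps eps0.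
apply/nbhs_complexP; pose M := C + nrm d + 1.
have M0 : 0 < M by have := nrm_ge0 d; rewrite /M; lra.
exists (Num.min e (Num.min 1 (eps / M))).
  by rewrite !lt_min e0 ltr01 divr_gt0.
move=> w; rewrite !lt_min => /and3P[we w1 weps].
have := He _ we; rewrite [z + _]addrC subrK => {}He.
have -> : f w - f z = (f w - f z - d * (w - z)) + d * (w - z) by ring.
rewrite (le_lt_trans (ler_nrmD _ _))// Normc.normcM.
move: weps; rewrite ltr_pdivlMr//.
have := nrm_ge0 (w - z); have := nrm_ge0 d; move: He w1.
rewrite /M; move: (nrm (w - z)) (nrm d) => x y.
move: (nrm _) => t tC x1 y0 x0.
have : C * x ^+ 2 <= C * x by rewrite ler_wpM2l// expr2 ler_piMl// ltW.
nra.
Qed.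

Lemma qderiv_derive1 f z d : qderiv f z d ->
  derivable f z 1 /\ f^`()%classic z = d.
Proof.
move=> [C C0 [e e0 He]].
have H : h^-1 *: ((f \o shift z) (h *: 1) - f z) @[h --> 0^'] --> d.
  apply/cvg_complexP => eps eps0; rewrite near_withinE.
  apply/nbhs_complexP; exists (Num.min e (eps / (C + 1))).
    by rewrite lt_min e0 divr_gt0// ltr_wpDl.
  move=> h; rewrite subr0 lt_min => /andP[he heps] h0 /=.
  have {}He := He _ he.
  have -> : h^-1 *: (f (h *: 1 + z) - f z) - d =
      h^-1 * (f (z + h) - f z - d * h).
    rewrite (_ : h *: 1 + z = z + h); last by rewrite addrC; congr (_ + _);
      exact: mulr1.
    rewrite -[h^-1 *: _]/(h^-1 * _).
    by field; exact: h0.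
  rewrite Normc.normcM Normc.normcV.
  have h0' : 0 < nrm h by rewrite nrm_gt0.
  rewrite ltr_pdivrMl//; apply: le_lt_trans He _.
  move: heps; rewrite ltr_pdivlMr ?ltr_wpDl//.
  by move: h0'; move: (nrm h) => x; nra.
split; first by apply/cvg_ex; exists d.
by rewrite derive1E; exact: cvg_lim.
Qed.

Lemma qderiv_line f z d v w (t : R) : qderiv f (z + t%:C * v) d ->
  is_derive t 1 (fun s : R => re (w * f (z + s%:C * v))) (re (w * (d * v))).
Proof.
move=> [C C0 [e e0 He]].
pose g := fun s : R => re (w * f (z + s%:C * v)).
have H : h^-1 *: ((g \o shift t) (h *: 1) - g t) @[h --> 0^']
    --> re (w * (d * v)).
  apply/cvgrPdist_lt => eps eps0; near=> h.
  have h0 : h != 0 by near: h; exact: nbhs_dnbhs_neq.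
  have hv : `|h| * (nrm v + 1) < e.
    rewrite -ltr_pdivlMr ?ltr_wpDl ?nrm_ge0//.
    by near: h; apply: dnbhs0_lt; rewrite divr_gt0// ltr_wpDl ?nrm_ge0//.
  have hE : `|h| * (nrm w * (C * nrm v ^+ 2) + 1) < eps.
    have P : 0 < nrm w * (C * nrm v ^+ 2) + 1.
      by rewrite ltr_wpDl// !mulr_ge0 ?nrm_ge0 ?sqr_ge0.
    rewrite -ltr_pdivlMr//; near: h; apply: dnbhs0_lt.
    by rewrite divr_gt0// ltr_wpDl// !mulr_ge0 ?nrm_ge0 ?sqr_ge0.
  have := He (h%:C * v); rewrite Normc.normcM nrm_real.
  have hv' : `|h| * nrm v < e.
    apply: le_lt_trans hv; rewrite ler_wpM2l//; lra.
  move=> /(_ hv') {}He.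
  rewrite distrC.
  have -> : h^-1 *: ((g \o shift t) (h *: 1) - g t) - re (w * (d * v)) =
      re (h^-1%:C * (w * (f (z + t%:C * v + h%:C * v) - f (z + t%:C * v) -
        d * (h%:C * v)))).
    rewrite /g /= [h *: 1]mulr1 /GRing.scale /=.
    have -> : z + (h + t)%:C * v = z + t%:C * v + h%:C * v.
      by rewrite rmorphD /=; ring.
    move: (f _) (f _) => [a b] [a' b'].
    clear -h0; case: w d v => [? ?] [? ?] [? ?] /=; field => //.
  apply: le_lt_trans (ler_re_nrm _) _.
  rewrite !Normc.normcM nrm_real normfV ltr_pdivrMl ?normr_gt0//.
  apply: le_lt_trans (ler_wpM2l (nrm_ge0 _) He) _.
  have h0' : 0 < `|h| by rewrite normr_gt0.
  rewrite -(ltr_pM2l h0') in hE; apply: le_lt_trans hE.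
  have -> : nrm w * (C * (`|h| * nrm v) ^+ 2) =
    `|h| * (`|h| * (nrm w * (C * nrm v ^+ 2))) by ring.
  by rewrite !ler_wpM2l// lerDl.
apply: DeriveDef; first by apply/cvg_ex; eexists; exact: H.
exact: cvg_lim.
Unshelve. all: by end_near.
Qed.

(** Complex-valued functions have no mean value theorem, but the real functional Re (w * _)
    restricted to a segment does. The choice of [w] adapts it to each use below. *)
Lemma MVT_re f F z v w :
  (forall t : R, 0 <= t <= 1 -> qderiv f (z + t%:C * v) (F (z + t%:C * v))) ->
  exists2 c : R, 0 < c < 1 &
    re (w * (f (z + v) - f z)) = re (w * (F (z + c%:C * v) * v)).
Proof.
move=> fF; pose g := fun s : R => re (w * f (z + s%:C * v)).
have H (t : R) :
  0 <= t <= 1 -> is_derive t 1 g (re (w * (F (z + t%:C * v) * v))).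
  by move=> t01; apply: qderiv_line; exact: fF.
have [||c /itvP c01] :=
  @MVT R g (fun t => re (w * (F (z + t%:C * v) * v))) 0 1 ltr01.
- by move=> x /itvP x01; apply: H; rewrite !x01.
- apply: continuous_in_subspaceT => x; rewrite inE /= => /itvP x01.
  by apply/differentiable_continuous/derivable1_diffP; case: (H x) => //;
    rewrite !x01.
rewrite subr0 mulr1 => E; exists c; first by rewrite !c01.
rewrite -E /g mul1r mul0r addr0 -raddfB /= mulrBr.
by [].
Qed.

End QuadraticDerivative.

(** * Convergence and termwise estimates for complex series *)

Section ComplexSeries.
Variable R : realType.
Implicit Types (u v : R[i] ^nat) (s t a z h : R[i]).

(** Absolute convergence, reduced to the two real series of real and imaginary parts, whose terms
    are dominated by the moduli. *)
Lemma cvg_series_bounded u M :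
  (forall N, \sum_(0 <= k < N) nrm (u k) <= M) -> cvgn (series u).
Proof.
move=> uM.
have aux (g : R[i] -> R) : (forall z, `|g z| <= nrm z) ->
    cvgn (series (fun k => g (u k))).
  move=> gn; apply: normed_cvg; apply: nondecreasing_is_cvgn.
    by apply: nondecreasing_series => k _ _; exact: normr_ge0.
  exists M => _ [n _ <-]; apply: le_trans (uM n).
  by rewrite /series /=; apply: ler_sum => k _; exact: gn.
have /cvg_ex[a ca] := aux _ (@ler_re_nrm R).
have /cvg_ex[b cb] := aux _ (@ler_im_nrm R).
apply/cvg_ex; exists (a +i* b); apply/cvg_complexP => e e0.
have e20 : 0 < e / 2 by rewrite divr_gt0.
move/cvgrPdist_lt : ca => /(_ _ e20) ca.
move/cvgrPdist_lt : cb => /(_ _ e20) cb.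
near=> n.
apply: le_lt_trans (ler_nrm_reim _) _.
rewrite reB imB /= /series /= !raddf_sum /=.
rewrite [e]splitr ltrD//.
  by rewrite distrC; near: n; exact: ca.
by rewrite distrC; near: n; exact: cb.
Unshelve. all: by end_near.
Qed.

Lemma cvg_nrm_le u s M : u @ \oo --> s -> (forall n, nrm (u n) <= M) ->
  nrm s <= M.
Proof.
move=> /cvg_complexP us uM;
  apply/ler_addgt0Pr => e /us[N _ /(_ N (leqnn N))] /= H.
apply: le_trans (ler_nrm_dist _ (u N)) _.
by rewrite nrmB lerD// ltW.
Qed.

Lemma cvg_re_ge u s (x : R) N : u @ \oo --> s ->
  (forall n, (N <= n)%N -> x <= re (u n)) -> x <= re s.
Proof.
move=> /cvg_complexP us xu; apply/ler_addgt0Pr => e /us[m _ H].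
have := H _ (leq_maxl m N); have := xu _ (leq_maxr m N).
move: (maxn m N) => n xn /= un; apply: le_trans xn _.
rewrite -lerBlDl -reB; apply: le_trans (re_le_nrm _) _; exact: ltW.
Qed.

Lemma cvg_series_nrm_le u s M : series u @ \oo --> s ->
  (forall N, \sum_(0 <= k < N) nrm (u k) <= M) -> nrm s <= M.
Proof.
move=> us uM; apply: (cvg_nrm_le us) => n; apply: le_trans (uM n).
rewrite /series /=; elim: n => [|n IH]; first by rewrite !big_nil Normc.normc0.
by rewrite !big_nat_recr//=; apply: le_trans (ler_nrmD _ _) _; rewrite lerD2r.
Qed.

Lemma cvg_series_re_ge u s n : series u @ \oo --> s ->
  (forall k, 0 <= re (u k)) -> re (u n) <= re s.
Proof.
move=> us u0; apply: (cvg_re_ge us (N := n.+1)) => m nm.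
rewrite /series /= raddf_sum /= (bigD1_seq n)/= ?mem_index_iota ?iota_uniq//.
by rewrite lerDl sumr_ge0.
Qed.

Lemma cvg_series_scale u s a : series u @ \oo --> s ->
  series (fun k => a * u k) @ \oo --> a * s.
Proof.
move=> us; have -> : series (fun k => a * u k) = fun n => a * series u n.
  by apply/funext => n; rewrite /series /= big_distrr.
exact: (cvgM (cvg_cst a) us).
Qed.

Lemma cvg_seriesB u v s t : series u @ \oo --> s -> series v @ \oo --> t ->
  series (fun k => u k - v k) @ \oo --> s - t.
Proof.
move=> us vt.
have -> : series (fun k => u k - v k) = fun n => series u n - series v n.
  by apply/funext => n; rewrite /series /= sumrB.
exact: (cvgB us vt).
Qed.

Lemma series_taylor u u' v s s' t h (M : R ^nat) B :
  series u @ \oo --> s -> series u' @ \oo --> s' -> series v @ \oo --> t ->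
  (forall k, nrm (u' k - u k - v k * h) <= M k * nrm h ^+ 2) ->
  (forall N, \sum_(0 <= k < N) M k <= B) ->
  nrm (s' - s - t * h) <= B * nrm h ^+ 2.
Proof.
move=> us us' vt uM MB.
have H := cvg_seriesB (cvg_seriesB us' us) (cvg_series_scale (a := h) vt).
rewrite [t * h]mulrC; apply: (cvg_series_nrm_le H) => N.
apply: (@le_trans _ _ (\sum_(0 <= k < N) M k * nrm h ^+ 2)).
  by apply: ler_sum => k _; rewrite [h * _]mulrC.
by rewrite -mulr_suml ler_wpM2r ?sqr_ge0.
Qed.

Lemma sum_geometric_le (x : R) N : 0 <= x < 1 ->
  \sum_(0 <= k < N) x ^+ k <= (1 - x)^-1.
Proof.
move=> /andP[x0 x1]; have x1' : 0 < 1 - x by rewrite subr_gt0.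
rewrite -div1r ler_pdivlMr// mulrC big_mkord.
have := subrX1 x N; have := exprn_ge0 N x0; lra.
Qed.

Lemma sum_diff_geometric_le (x : R) N : 0 <= x < 1 ->
  \sum_(0 <= k < N) k%:R * x ^+ k.-1 <= ((1 - x) ^+ 2)^-1.
Proof.
move=> /andP[x0 x1]; have x1' : 0 < 1 - x by rewrite subr_gt0.
rewrite -div1r ler_pdivlMr ?exprn_gt0//.
(* Closed form of the differentiated geometric sum; the subtracted terms are nonnegative. At [k = 0]
   the exponent [k.-1] is 0, but the coefficient vanishes. *)
have E n : (\sum_(0 <= k < n.+1) k%:R * x ^+ k.-1) * (1 - x) ^+ 2 =
    1 - x ^+ n - n%:R * x ^+ n * (1 - x).
  elim: n => [|n IH]; first
    by rewrite big_nat1 mul0r mul0r expr0 subrr mul0r subr0.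
  by rewrite big_nat_recr//= mulrDl IH -[n.+1%:R]natr1 (exprS x n); ring.
case: N => [|N]; first by rewrite big_nil mul0r.
rewrite E -addrA gerDl -opprD oppr_le0 addr_ge0 ?exprn_ge0//.
by rewrite !mulr_ge0 ?exprn_ge0// ltW.
Qed.

Lemma cvg_complex_geometric z : nrm z < 1 ->
  series (fun k => z ^+ k) @ \oo --> (1 - z)^-1.
Proof.
move=> z1; apply/cvg_complexP => e e0.
have z1' : 1 - z != 0.
  by rewrite subr_eq0; apply/eqP => E; rewrite -E Normc.normc1 ltxx in z1.
have n0 : 0 < nrm (1 - z) by rewrite nrm_gt0.
have := @cvg_expr R (nrm z); rewrite ger0_norm ?nrm_ge0// => /(_ z1).
move=> /cvgrPdist_lt /(_ (e * nrm (1 - z))); rewrite mulr_gt0// => /(_ isT).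
apply: filterS => n; rewrite sub0r normrN ger0_norm ?exprn_ge0 ?nrm_ge0//.
move=> H; rewrite -ltr_pdivrMr// -nrmX in H.
apply: le_lt_trans H; rewrite -Normc.normcV -Normc.normcM -[leRHS]normcN.
have -> // : series (fun k => z ^+ k) n - (1 - z)^-1 = - (z ^+ n / (1 - z)).
rewrite /series /= big_mkord; have := subrX1 z n.
move: (\sum_(i < n) _) => S E.
have -> : z ^+ n = 1 + (z - 1) * S by rewrite -E addrC subrK.
by field; exact: z1'.
Qed.

End ComplexSeries.

(** * The power series of the logarithm and its Taylor estimate *)

Section Logarithm.
Variable R : realType.
Implicit Types (z h : R[i]) (x : R).

(* [- log (1 - z)] *)
Definition mercator z : R[i] :=
  limn (series (fun k => z ^+ k.+1 / k.+1%:R)).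

Lemma nrm_mercator_term z k : nrm (z ^+ k.+1 / k.+1%:R) <= nrm z ^+ k.+1.
Proof.
rewrite Normc.normcM Normc.normcV nrm_nat nrmX ler_pdivrMr//.
by rewrite ler_peMr ?exprn_ge0 ?nrm_ge0// ler1n.
Qed.

Lemma sum_mercator_le z N : nrm z < 1 ->
  \sum_(0 <= k < N) nrm (z ^+ k.+1 / k.+1%:R) <= nrm z / (1 - nrm z).
Proof.
move=> z1.
apply: (@le_trans _ _ (nrm z * \sum_(0 <= k < N) nrm z ^+ k)).
  rewrite mulr_sumr; apply: ler_sum => k _; rewrite -exprS.
  exact: nrm_mercator_term.
by rewrite ler_wpM2l ?nrm_ge0// sum_geometric_le// nrm_ge0.
Qed.

Lemma cvg_mercator z : nrm z < 1 ->
  series (fun k => z ^+ k.+1 / k.+1%:R) @ \oo --> mercator z.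
Proof.
move=> z1; apply: (cvg_series_bounded (M := nrm z / (1 - nrm z))) => N.
exact: sum_mercator_le.
Qed.

Lemma nrm_mercator_le z : nrm z < 1 -> nrm (mercator z) <= nrm z / (1 - nrm z).
Proof.
move=> z1; apply: (cvg_series_nrm_le (cvg_mercator z1)) => N.
exact: sum_mercator_le.
Qed.

(** Induction on [k], splitting off one factor [z + h]. The factor [k.+1%:R] of the bound cancels
    the denominator in the logarithmic series and leaves the summable terms [k%:R * x ^+ k.-1]. *)
Lemma expr_taylor (x : R) z h k : nrm z <= x -> nrm (z + h) <= x ->
  nrm ((z + h) ^+ k.+1 - z ^+ k.+1 - k.+1%:R * z ^+ k * h) <=
    k.+1%:R * (k%:R * x ^+ k.-1 * nrm h ^+ 2).
Proof.
move=> zx zhx; have x0 : 0 <= x := le_trans (nrm_ge0 _) zx.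
elim: k => [|k IH].
  rewrite !expr1 expr0 (_ : _ - _ = 0) ?Normc.normc0 ?mul0r ?mulr0//.
  by rewrite !mulr1 mul1r; ring.
have -> : (z + h) ^+ k.+2 - z ^+ k.+2 - k.+2%:R * z ^+ k.+1 * h =
    (z + h) * ((z + h) ^+ k.+1 - z ^+ k.+1 - k.+1%:R * z ^+ k * h) +
    k.+1%:R * z ^+ k * h ^+ 2.
  by rewrite -[k.+2%:R]natr1 !exprS expr0; ring.
apply: le_trans (ler_nrmD _ _) _.
rewrite !Normc.normcM !nrmX nrm_nat /=.
apply: (@le_trans _ _ (x * (k.+1%:R * (k%:R * x ^+ k.-1 * nrm h ^+ 2)) +
    k.+1%:R * x ^+ k * nrm h ^+ 2)).
  apply: lerD; first by rewrite ler_pM ?nrm_ge0.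
  by rewrite ler_wpM2r ?sqr_ge0// ler_wpM2l// lerXn2r ?nnegrE ?nrm_ge0.
have -> : x * (k.+1%:R * (k%:R * x ^+ k.-1 * nrm h ^+ 2)) =
    k.+1%:R * (k%:R * x ^+ k * nrm h ^+ 2).
  by case: k {IH} => [|k] /=; rewrite ?mul0r ?mulr0 ?exprS; ring.
rewrite -[k.+2%:R]natr1; have := exprn_ge0 k x0; have := sqr_ge0 (nrm h).
rewrite -[k.+1%:R]natr1; have := ler0n R k.
move: (x ^+ k) (nrm h ^+ 2) (k%:R : R) => A B C C0 B0 A0.
have := mulr_ge0 A0 B0 => AB; have := mulr_ge0 C0 AB; nra.
Qed.

Lemma mercator_taylor x z h : x < 1 -> nrm z <= x -> nrm (z + h) <= x ->
  nrm (mercator (z + h) - mercator z - (1 - z)^-1 * h) <=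
    ((1 - x) ^+ 2)^-1 * nrm h ^+ 2.
Proof.
move=> x1 zx zhx; have x0 : 0 <= x := le_trans (nrm_ge0 _) zx.
apply: (series_taylor (cvg_mercator (le_lt_trans zx x1))
  (cvg_mercator (le_lt_trans zhx x1))
  (cvg_complex_geometric (le_lt_trans zx x1))
  (M := fun k => k%:R * x ^+ k.-1)).
  move=> k.
  have k0 : k.+1%:R != 0 :> R[i] by rewrite pnatr_eq0.
  have -> : (z + h) ^+ k.+1 / k.+1%:R - z ^+ k.+1 / k.+1%:R - z ^+ k * h =
      k.+1%:R^-1 * ((z + h) ^+ k.+1 - z ^+ k.+1 - k.+1%:R * z ^+ k * h).
    move: ((z + h) ^+ _) (z ^+ k.+1) (z ^+ k) => a b c.
    by field; rewrite addrC natr1.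
  rewrite Normc.normcM Normc.normcV nrm_nat ler_pdivrMl//.
  exact: expr_taylor.
by move=> N; apply: sum_diff_geometric_le; rewrite x0.
Qed.

Lemma mercator0 : mercator 0 = 0.
Proof.
apply/eqP; rewrite -nrm_eq0 eq_le nrm_ge0 andbT.
have := @nrm_mercator_le 0; rewrite Normc.normc0 mul0r; exact.
Qed.

End Logarithm.

(** * Rational parametrization of the unit circle *)

Section Cayley.
Variable R : realType.
Implicit Types (s t : R) (z w : R[i]).

(* [(1 + i t) / (1 - i t)] *)
Definition cayley t : R[i] :=
  ((1 - t ^+ 2) / (1 + t ^+ 2)) +i* (2 * t / (1 + t ^+ 2)).

Let den_gt0 t : 0 < 1 + t ^+ 2.
Proof. by rewrite ltr_pwDl// sqr_ge0. Qed.

Lemma nrm_cayley t : nrm (cayley t) = 1.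
Proof.
apply: (@pexpIrn _ 2) => //; rewrite ?nnegrE ?nrm_ge0// expr1n nrm_sqr /=.
by field; rewrite gt_eqF.
Qed.

(** The squared chord equals 4 (s - t)^2 / ((1 + s^2) (1 + t^2)), and on [0, 1] each factor of the
    denominator is at most 2. *)
Lemma cayley_dist s t : 0 <= s <= 1 -> 0 <= t <= 1 ->
  `|s - t| <= nrm (cayley s - cayley t).
Proof.
move=> /andP[s0 s1] /andP[t0 t1].
rewrite -(@ler_pXn2r _ 2)// ?nnegrE ?nrm_ge0// real_normK ?num_real// nrm_sqr.
rewrite reB imB /=.
have -> : ((1 - s ^+ 2) / (1 + s ^+ 2) - (1 - t ^+ 2) / (1 + t ^+ 2)) ^+ 2 +
    (2 * s / (1 + s ^+ 2) - 2 * t / (1 + t ^+ 2)) ^+ 2 =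
    4 / ((1 + s ^+ 2) * (1 + t ^+ 2)) * (s - t) ^+ 2.
  by field; rewrite !gt_eqF.
rewrite ler_peMl ?sqr_ge0// ler_pdivlMr ?mulr_gt0// mul1r.
have s2 : s ^+ 2 <= 1 by rewrite exprn_ile1.
have t2 : t ^+ 2 <= 1 by rewrite exprn_ile1.
rewrite (_ : 4 = (1 + 1) * (1 + 1)); last by ring.
by rewrite ler_pM ?(ltW (den_gt0 _))// lerD2l.
Qed.

(** The argument of [cayley t] is 2 arctan t, which increases with [t] and stays below pi. *)
Lemma im_cayley_conj s t :
  0 <= s -> s < t -> im (cayley s * (conjc (cayley t))) < 0.
Proof.
move=> s0 st; have t0 := le_lt_trans s0 st.
have -> : im (cayley s * (conjc (cayley t))) =
    - (2 * (t - s) * (1 + s * t) / ((1 + s ^+ 2) * (1 + t ^+ 2))).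
  by rewrite imM /=; field; rewrite !gt_eqF.
rewrite oppr_lt0 divr_gt0 ?mulr_gt0 ?subr_gt0//.
by rewrite ltr_pwDl// mulr_ge0// ltW.
Qed.

End Cayley.

(** * The function [log_sum]: derivative, positivity, behaviour at poles and gaps *)

Section LogarithmicSum.
Variable R : realType.
Implicit Types (z w h : R[i]) (x r : R).

(* [log_sum] is bounded on the radii ending at the gaps because the weights are
   summable even after division by the distances [pole_gap_dist]. *)
Definition pole_param n : R := 4^-1 ^+ n.
Definition gap_param n : R := pole_param n / 2.
Definition weight n : R := 7 / 8 * 8^-1 ^+ n.

Definition pole n := cayley (pole_param n).
Definition gap n := cayley (gap_param n).

Lemma pole_param_gt0 n : 0 < pole_param n.
Proof. by rewrite exprn_gt0// invr_gt0. Qed.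

Lemma pole_param_le1 n : pole_param n <= 1.
Proof. by rewrite exprn_ile1// ?invr_ge0// invf_le1// ler1n. Qed.

Lemma gap_param_gt0 n : 0 < gap_param n.
Proof. by rewrite divr_gt0// pole_param_gt0. Qed.

Lemma gap_param_le1 n : gap_param n <= 1.
Proof. have := pole_param_le1 n; have := pole_param_gt0 n; rewrite /gap_param;
  lra. Qed.

Lemma pole_paramS n : pole_param n.+1 = pole_param n / 4.
Proof. by rewrite /pole_param exprS mulrC. Qed.

Lemma pole_param_le m n : (m <= n)%N -> pole_param n <= pole_param m.
Proof.
by move=> mn; rewrite /pole_param ler_wiXn2l// ?invr_ge0// invf_le1// ler1n.
Qed.

(** The parameter of the gap is at most half of [pole_param n] if [n <= j], and at least twice
    [pole_param n] if [j < n]. *)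
Lemma pole_gap_dist n j : pole_param n / 2 <= nrm (pole n - gap j).
Proof.
have pg : pole_param n / 2 <= `|pole_param n - gap_param j|.
  rewrite ler_normr /gap_param; have := pole_param_gt0 n.
  case: (leqP n j) => [/pole_param_le|/pole_param_le]; first by move=> *;
    apply/orP; left; lra.
  by rewrite pole_paramS => *; apply/orP; right; lra.
apply: le_trans pg (cayley_dist _ _).
  by rewrite pole_param_le1 ltW// pole_param_gt0.
by rewrite gap_param_le1 ltW// gap_param_gt0.
Qed.

Lemma weight_gt0 n : 0 < weight n.
Proof. by rewrite mulr_gt0// ?exprn_gt0 ?invr_gt0// divr_gt0. Qed.

(** The factor 7/8 in [weight] makes the total mass 1, which normalizes the derivative at 0 to 1. *)
Lemma sum_weight N : \sum_(0 <= n < N) weight n = 1 - 8^-1 ^+ N.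
Proof.
elim: N => [|N IH]; first by rewrite big_nil expr0 subrr.
by rewrite big_nat_recr//= IH /weight (exprS _ N); field.
Qed.

Lemma sum_weight_le N x : 0 <= x -> \sum_(0 <= n < N) weight n * x <= x.
Proof.
by move=> x0; rewrite -mulr_suml sum_weight ler_piMl// gerBl exprn_ge0.
Qed.

(** The primitive of [log_sum'] that vanishes at 0: the factor [pole n] cancels the [conjc (pole n)]
    produced by the chain rule. *)
Definition log_sum z : R[i] := limn (series (fun n =>
  (weight n)%:C * (pole n * mercator (conjc (pole n) * z)))).

Definition log_sum' z : R[i] := limn (series (fun n =>
  (weight n)%:C * (1 - conjc (pole n) * z)^-1)).

Lemma nrm_pole n : nrm (pole n) = 1. Proof. exact: nrm_cayley. Qed.

Lemma nrm_gap n : nrm (gap n) = 1. Proof. exact: nrm_cayley. Qed.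

Lemma nrm_pole_conj n z : nrm (conjc (pole n) * z) = nrm z.
Proof. by rewrite Normc.normcM nrm_conj nrm_pole mul1r. Qed.

Lemma nrm_weight n : nrm (weight n)%:C = weight n.
Proof. by rewrite nrm_real ger0_norm// ltW// weight_gt0. Qed.

Lemma cvg_log_sum z : nrm z < 1 -> series (fun n =>
  (weight n)%:C * (pole n * mercator (conjc (pole n) * z))) @ \oo --> log_sum z.
Proof.
move=> z1; apply: (cvg_series_bounded (M := nrm z / (1 - nrm z))) => N.
apply: le_trans (sum_weight_le N _).
  apply: ler_sum => n _; rewrite !Normc.normcM nrm_weight nrm_pole mul1r.
  rewrite ler_pM2l ?weight_gt0//.
  by apply: le_trans (nrm_mercator_le _) _; rewrite nrm_pole_conj.
by rewrite divr_ge0 ?nrm_ge0// subr_ge0 ltW.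
Qed.

Lemma nrm_sub1_ge w : 1 - nrm w <= nrm (1 - w).
Proof. by rewrite lerBlDl; have := ler_nrm_dist 1 w; rewrite Normc.normc1. Qed.

Lemma cvg_log_sum' z : nrm z < 1 -> series (fun n =>
  (weight n)%:C * (1 - conjc (pole n) * z)^-1) @ \oo --> log_sum' z.
Proof.
move=> z1; apply: (cvg_series_bounded (M := (1 - nrm z)^-1)) => N.
have P : 0 < 1 - nrm z by rewrite subr_gt0.
apply: le_trans (sum_weight_le N _); last by rewrite invr_ge0 ltW.
apply: ler_sum => n _; rewrite !Normc.normcM nrm_weight.
rewrite ler_pM2l ?weight_gt0// Normc.normcV lef_pV2 ?posrE//.
  by rewrite -(nrm_pole_conj n z) nrm_sub1_ge.
by apply: lt_le_trans P _; rewrite -(nrm_pole_conj n z) nrm_sub1_ge.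
Qed.

Lemma qderiv_log_sum z : nrm z < 1 -> qderiv log_sum z (log_sum' z).
Proof.
(* The midpoint between |z| and 1: [z] and [z + h] both stay in the disk of radius [x], so one
   remainder constant serves all terms. *)
move=> z1; pose x := (1 + nrm z) / 2.
have x1 : x < 1 by rewrite /x; lra.
exists ((1 - x) ^+ 2)^-1; first by rewrite invr_ge0 sqr_ge0.
exists ((1 - nrm z) / 2); first by lra.
move=> h hz.
have zx : nrm z <= x by rewrite /x; lra.
have zhx : nrm (z + h) <= x.
  by apply: le_trans (ler_nrmD _ _) _; rewrite /x; lra.
apply: (series_taylor (cvg_log_sum z1) (cvg_log_sum (le_lt_trans zhx x1))
  (cvg_log_sum' z1)
  (M := fun n => weight n * ((1 - x) ^+ 2)^-1)) => [n|N]; last first.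
  by apply: sum_weight_le; rewrite invr_ge0 sqr_ge0.
have -> : (weight n)%:C * (pole n * mercator (conjc (pole n) * (z + h))) -
    (weight n)%:C * (pole n * mercator (conjc (pole n) * z)) -
    (weight n)%:C * (1 - conjc (pole n) * z)^-1 * h =
    (weight n)%:C * (pole n *
      (mercator (conjc (pole n) * z + conjc (pole n) * h) -
    mercator (conjc (pole n) * z) -
      (1 - conjc (pole n) * z)^-1 * (conjc (pole n) * h))).
  have := mul_conj (pole n); rewrite nrm_pole expr1n.
  rewrite mulrDr; move: (mercator _) (mercator _) (_^-1) => b a c E.
  transitivity ((weight n)%:C * (pole n * a) - (weight n)%:C * (pole n * b) -
    (weight n)%:C * c * h * (pole n * conjc (pole n))); last by ring.
  by rewrite E mulr1.
rewrite !Normc.normcM nrm_weight nrm_pole mul1r -mulrA ler_pM2l ?weight_gt0//.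
have := @mercator_taylor R x (conjc (pole n) * z) (conjc (pole n) * h) x1.
by rewrite -mulrDr !nrm_pole_conj; exact.
Qed.

Lemma log_sum0 : log_sum 0 = 0.
Proof.
have := @cvg_log_sum 0; rewrite Normc.normc0 ltr01 => /(_ isT) H.
apply/eqP; rewrite -nrm_eq0 eq_le nrm_ge0 andbT.
apply: (cvg_series_nrm_le H) => N.
by rewrite big1// => n _; rewrite mulr0 mercator0 !mulr0 Normc.normc0.
Qed.

Lemma log_sum'0 : log_sum' 0 = 1.
Proof.
have := @cvg_log_sum' 0; rewrite Normc.normc0 ltr01 => /(_ isT).
have -> : series (fun n => (weight n)%:C * (1 - conjc (pole n) * 0)^-1) =
    fun N => (1 - 8^-1 ^+ N)%:C :> R[i].
  apply/funext => N; rewrite -sum_weight /series /= rmorph_sum /=.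
  by apply: eq_bigr => n _; rewrite mulr0 subr0 invr1 mulr1.
move=> /cvg_complexP H; apply/eqP;
  rewrite -subr_eq0 -nrm_eq0 eq_le nrm_ge0 andbT.
apply/ler_addgt0Pr => e e0; rewrite add0r.
have e20 : 0 < e / 2 by rewrite divr_gt0.
have := @cvg_expr R 8^-1; rewrite ger0_norm ?invr_ge0// invf_lt1// ltr1n.
move=> /(_ isT)/cvgrPdist_lt/(_ _ e20)[N _ HN]; have [m _ Hm] := H _ e20.
have := HN _ (leq_maxl N m); have := Hm _ (leq_maxr N m).
move: (maxn N m) => n /= H1; rewrite sub0r normrN => H2.
apply: le_trans (ler_nrm_dist _ ((1 - 8^-1 ^+ n)%:C - 1)) _.
have E : (1 - 8^-1 ^+ n)%:C - 1 = (- 8^-1 ^+ n)%:C :> R[i].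
  by apply: complex_ext; rewrite reimE /=; ring.
rewrite [e]splitr lerD//; first by rewrite E nrm_real normrN ltW.
by rewrite opprB addrA subrK nrmB ltW.
Qed.

Lemma re_inv z : re z^-1 = re z / nrm z ^+ 2.
Proof. by rewrite nrm_sqr; case: z. Qed.

Lemma re_inv_sub1_gt0 z : nrm z < 1 -> 0 < re (1 - z)^-1.
Proof.
move=> z1; rewrite re_inv divr_gt0 ?reB ?subr_gt0//.
  exact: le_lt_trans (re_le_nrm z) z1.
by rewrite exprn_gt0//; apply: lt_le_trans (nrm_sub1_ge z); rewrite subr_gt0.
Qed.

(** The map 1 / (1 - w) sends the disk into the right half-plane, so all terms have positive real
    part and each single one bounds the sum from below. *)
Lemma re_log_sum'_ge z n : nrm z < 1 ->
  weight n * re (1 - conjc (pole n) * z)^-1 <= re (log_sum' z).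
Proof.
move=> z1; have E k : re ((weight k)%:C * (1 - (conjc (pole k)) * z)^-1) =
    weight k * re (1 - (conjc (pole k)) * z)^-1 by rewrite reM /= mul0r subr0.
rewrite -E; apply: (cvg_series_re_ge n (cvg_log_sum' z1)) => k.
rewrite E mulr_ge0 ?(ltW (weight_gt0 _))// ltW// re_inv_sub1_gt0//.
by rewrite nrm_pole_conj.
Qed.

Lemma re_log_sum'_gt0 z : nrm z < 1 -> 0 < re (log_sum' z).
Proof.
move=> z1; apply: lt_le_trans (re_log_sum'_ge 0 z1).
by rewrite mulr_gt0 ?weight_gt0// re_inv_sub1_gt0// nrm_pole_conj.
Qed.

(** On this radius the term of the pole itself is exactly [weight n / (1 - r)]. Its divergent
    integral drives the image of the radius to infinity. *)
Lemma re_log_sum'_pole_ge n r : 0 <= r < 1 ->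
  weight n / (1 - r) <= re (log_sum' (r%:C * pole n)).
Proof.
move=> /andP[r0 r1].
have n1 : nrm (r%:C * pole n) < 1.
  by rewrite Normc.normcM nrm_pole mulr1 nrm_real ger0_norm.
apply: le_trans (re_log_sum'_ge n n1).
have -> : 1 - conjc (pole n) * (r%:C * pole n) = (1 - r)%:C.
  rewrite mulrCA [conjc _ * _]mulrC mul_conj nrm_pole expr1n -rmorphM mulr1.
  by rewrite rmorphB.
by rewrite -fmorphV.
Qed.

Lemma nrm_log_sum'_gap_le j r :
  0 <= r < 1 -> nrm (log_sum' (r%:C * gap j)) <= 7.
Proof.
move=> /andP[r0 r1].
have n1 : nrm (r%:C * gap j) < 1.
  by rewrite Normc.normcM nrm_gap mulr1 nrm_real ger0_norm.
apply: (cvg_series_nrm_le (cvg_log_sum' n1)) => N.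
(* Moving from the gap to radius [r] costs [1 - r], which is itself at most the distance to be
   estimated; hence this distance is at least half of the one at the gap. *)
have D n : pole_param n / 4 <= nrm (1 - conjc (pole n) * (r%:C * gap j)).
  have E : nrm (1 - conjc (pole n) * gap j) = nrm (pole n - gap j).
    rewrite -[RHS](nrm_pole_conj n) mulrBr [conjc _ * pole n]mulrC mul_conj.
    by rewrite nrm_pole expr1n.
  have := pole_gap_dist n j; rewrite -E => H.
  have T : nrm (1 - conjc (pole n) * gap j) <=
      nrm (1 - conjc (pole n) * (r%:C * gap j)) + (1 - r).
    apply: le_trans (ler_nrm_dist _ (1 - conjc (pole n) * (r%:C * gap j))) _.
    rewrite lerD2l.
    have -> : 1 - conjc (pole n) * gap j -
      (1 - conjc (pole n) * (r%:C * gap j)) =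
        (r - 1)%:C * (conjc (pole n) * gap j) by rewrite rmorphB /=; ring.
    rewrite Normc.normcM nrm_pole_conj nrm_gap mulr1 nrm_real distrC.
    by rewrite ger0_norm// subr_ge0 ltW.
  have U := nrm_sub1_ge (conjc (pole n) * (r%:C * gap j)).
  rewrite nrm_pole_conj Normc.normcM nrm_gap mulr1 nrm_real ger0_norm// in U.
  by lra.
(* A weight of order 8^-n over a distance of order 4^-n leaves a geometric series of ratio 1/2, with
   total 7. *)
apply: (@le_trans _ _ (\sum_(0 <= n < N) 7 / 2 * 2^-1 ^+ n)).
  apply: ler_sum => n _; rewrite Normc.normcM nrm_weight Normc.normcV.
  have p0 := pole_param_gt0 n.
  have d0 : 0 < pole_param n / 4 by rewrite divr_gt0.
  rewrite ler_pdivrMr ?(lt_le_trans d0)//.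
  apply: le_trans (ler_wpM2l _ (D n)); last first.
    by rewrite mulr_ge0// ?exprn_ge0 ?invr_ge0// divr_ge0.
  rewrite /weight /pole_param (_ : 8^-1 = 2^-1 * 4^-1 :> R); last by field.
  by rewrite exprMn; move: (_ ^+ n) (_ ^+ n) => a b; lra.
rewrite -mulr_sumr.
have := @sum_geometric_le R 2^-1 N; rewrite invr_ge0 ler0n invf_lt1 ?ltr1n//=.
rewrite (_ : (1 - 2^-1)^-1 = 2 :> R); last by field.
by move=> /(_ isT); lra.
Qed.

(** With the conjugate of the value at the endpoint [v] as multiplier, the mean value theorem on
    [0, v] has |log_sum v|^2 on its left; one factor cancels against the bound for the
    derivative. *)
Lemma nrm_log_sum_gap_le j r : 0 <= r < 1 -> nrm (log_sum (r%:C * gap j)) <= 7.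
Proof.
move=> /andP[r0 r1]; pose v := r%:C * gap j.
have [|c /andP[c0 c1]] := @MVT_re R log_sum log_sum' 0 v (conjc (log_sum v)).
  move=> t /andP[t0 t1]; apply: qderiv_log_sum; rewrite add0r.
  rewrite !Normc.normcM nrm_gap !nrm_real mulr1 !ger0_norm//.
  by apply: le_lt_trans r1; rewrite ler_piMl.
rewrite !add0r log_sum0 subr0 [conjc _ * _]mulrC mul_conj /= => E.
have [->|v0] := eqVneq (log_sum v) 0; first by rewrite Normc.normc0.
have n0 : 0 < nrm (log_sum v) by rewrite nrm_gt0.
rewrite -(ler_pM2l n0) -expr2 E; apply: le_trans (re_le_nrm _) _.
rewrite Normc.normcM nrm_conj ler_pM2l// Normc.normcM.
apply: le_trans (_ : 7 * 1 <= _); last by rewrite mulr1.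
apply: ler_pM; rewrite ?nrm_ge0//.
  rewrite /v mulrA -rmorphM nrm_log_sum'_gap_le// mulr_ge0 ?(ltW c0)//=.
  by apply: le_lt_trans r1; rewrite ler_piMl// ltW.
by rewrite Normc.normcM nrm_gap nrm_real ger0_norm// mulr1 ltW.
Qed.

End LogarithmicSum.

(** * Monotonicity of a map whose derivative has positive real part *)

Section Monotone.
Variable R : realType.
Variables f F : R[i] -> R[i].
Hypothesis fF : forall z, nrm z < 1 -> qderiv f z (F z).
Hypothesis F_gt0 : forall z, nrm z < 1 -> 0 < re (F z).
Implicit Types (z w h a b : R[i]).

Lemma nrm_convex_lt1 z w (t : R) : nrm z < 1 -> nrm w < 1 -> 0 <= t <= 1 ->
  nrm (z + t%:C * (w - z)) < 1.
Proof.
move=> z1 w1 /andP[t0 t1].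
have -> : z + t%:C * (w - z) = (1 - t)%:C * z + t%:C * w.
  by rewrite rmorphB /=; ring.
apply: le_lt_trans (ler_nrmD _ _) _.
rewrite !Normc.normcM !nrm_real !ger0_norm ?subr_ge0//.
have zm : nrm z <= Num.max (nrm z) (nrm w) by rewrite le_max lexx.
have wm : nrm w <= Num.max (nrm z) (nrm w) by rewrite le_max lexx orbT.
have m1 : Num.max (nrm z) (nrm w) < 1 by rewrite gt_max z1.
have t1' : 0 <= 1 - t by rewrite subr_ge0.
have := ler_wpM2l t1' zm; have := ler_wpM2l t0 wm; lra.
Qed.

(** The disk is convex, so the mean value theorem on the segment gives Re F * |z - w|^2 at an
    intermediate point. This is the Noshiro-Warschawski argument for univalence. *)
Lemma strictly_monotone z w : nrm z < 1 -> nrm w < 1 -> z != w ->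
  0 < re ((f z - f w) * conjc (z - w)).
Proof.
move=> z1 w1 zw.
have [|c /andP[c0 c1]] := @MVT_re R f F w (z - w) (conjc (z - w)).
  by move=> t t01; apply/fF/nrm_convex_lt1.
rewrite [w + (z - w)]addrC subrK [in LHS]mulrC => ->.
rewrite mulrCA [conjc _ * _]mulrC mul_conj reM /= mulr0 subr0.
rewrite mulr_gt0 ?exprn_gt0 ?nrm_gt0 ?subr_eq0//.
by apply/F_gt0/nrm_convex_lt1; rewrite ?(ltW c0) ?(ltW c1).
Qed.

Lemma monotone z w : nrm z < 1 -> nrm w < 1 ->
  0 <= re ((f z - f w) * conjc (z - w)).
Proof.
move=> z1 w1; have [->|zw] := eqVneq z w; first by rewrite subrr mul0r.
exact/ltW/strictly_monotone.
Qed.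

Lemma monotone_closed a b z w :
  (forall e, 0 < e -> exists b' w', [/\ nrm (b' - b) < e, nrm (w' - w) < e &
    0 <= re ((a - b') * conjc (z - w'))]) ->
  0 <= re ((a - b) * conjc (z - w)).
Proof.
move=> H; rewrite -oppr_le0; apply/ler_addgt0Pr => e e0; rewrite add0r.
(* Passing from (b', w') to (b, w) costs at most |b' - b| |z - w'| + |a - b| |w' - w|; since |w' -
   w| < 1, the two coefficients add up to at most [M]. *)
pose M := nrm (z - w) + 1 + nrm (a - b).
have M0 : 0 < M by have := nrm_ge0 (z - w); have := nrm_ge0 (a - b);
  rewrite /M; lra.
have [|b' [w' [bb ww P]]] := H (Num.min 1 (e / M)).
  by rewrite lt_min ltr01 divr_gt0.
move: bb ww; rewrite !lt_min !ltr_pdivlMr// => /andP[b1 be] /andP[w1 we].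
have E : (a - b) * conjc (z - w) = (a - b') * conjc (z - w') +
    ((b' - b) * conjc (z - w') + (a - b) * conjc (w' - w)).
  by rewrite !rmorphB /=; ring.
rewrite E reD.
set Y := _ + _ * conjc (w' - w).
have : - re Y <= nrm Y by rewrite -reN -normcN re_le_nrm.
have : nrm Y <= nrm (b' - b) * nrm (z - w') + nrm (a - b) * nrm (w' - w).
  by apply: le_trans (ler_nrmD _ _) _; rewrite !Normc.normcM !nrm_conj.
have : nrm (z - w') <= nrm (z - w) + nrm (w' - w).
  by apply: le_trans (ler_nrm_dist _ (z - w)) _;
    rewrite lerD2l opprB addrC addrA subrK nrmB.
have := nrm_ge0 (b' - b); have := nrm_ge0 (a - b); have := nrm_ge0 (z - w).
have := nrm_ge0 (w' - w); have := nrm_ge0 (z - w').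
move: be we b1 w1 P; rewrite /M; move: (re _) (re _) => P Q.
move: (nrm Y) (nrm (z - w')) (nrm (z - w)) (nrm (w' - w)) (nrm (b' - b))
  (nrm (a - b)).
clear.
move=> Y A B C D E be we D1 C1 P0 A0 C0 B0 E0 D0 AB YY QY.
have H1 : D * A <= D * (B + 1) by rewrite ler_wpM2l//; lra.
have H : D * (B + 1) + E * C <= e.
  case: (leP C D) => CD.
    by have : E * C <= E * D by [rewrite ler_wpM2l]; nra.
  by have : D * (B + 1) <= C * (B + 1) by [rewrite ler_wpM2r ?addr_ge0// ltW];
    nra.
lra.
Qed.

End Monotone.

(** * Compactness and continuity of the modulus *)

Section Topology.
Variable R : realType.
Implicit Types (z w h a b : R[i]).

Let square (r : R) : set (R * R) := `[- r, r] `*` `[- r, r].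

Let compact_square r : compact (square r).
Proof. by apply: compact_setX; exact: segment_compact. Qed.

Lemma complex_bolzano_weierstrass (u : R[i] ^nat) B :
  (forall n, nrm (u n) <= B) ->
  exists b, forall e N, 0 < e -> exists2 n, (N <= n)%N & nrm (u n - b) < e.
Proof.
move=> uB; pose v n := (re (u n), im (u n)).
have [|[x y] [_ xy]] := @compact_square B (v @ \oo) _.
  exists 0%N => // n _; split => /=; rewrite in_itv /= -ler_norml.
    exact: le_trans (ler_re_nrm _) (uB n).
  exact: le_trans (ler_im_nrm _) (uB n).
exists (x +i* y) => e N e0; have e20 : 0 < e / 2 by rewrite divr_gt0.
have [||_ [[n Nn <-]]] := xy (v @` [set n | (N <= n)%N]) (ball (x, y) (e / 2)).
- by exists N => // n Nn; exists n.
- exact: nbhsx_ballx.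
move=> [/= xn yn]; exists n => //; apply: le_lt_trans (ler_nrm_reim _) _.
by rewrite reB imB /= [e]splitr ltrD// distrC.
Qed.

Lemma cvg_nrm (T : Type) (G : set_system T) (GG : Filter G) (g : T -> R[i]) a :
  g @ G --> a -> (fun t => nrm (g t)) @ G --> nrm a.
Proof.
move=> /cvg_complexP ga; apply/cvgrPdist_lt => e /ga; apply: filterS => t H.
have := ler_nrm_dist a (g t); have := ler_nrm_dist (g t) a.
rewrite [nrm (a - g t)]nrmB => H1 H2; apply: le_lt_trans H.
by rewrite ler_norml; apply/andP; split; lra.
Qed.

End Topology.

(** * Radial cluster values at the circle, and openness of the image *)

Section MonotoneMap.
Variable R : realType.
Variables f F : R[i] -> R[i].
Hypothesis fF : forall z, nrm z < 1 -> qderiv f z (F z).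
Hypothesis F_gt0 : forall z, nrm z < 1 -> 0 < re (F z).
Implicit Types (z w h a b : R[i]).

(** [b] is a cluster value of [f] at the radii 1 - 1/(n+1), and the monotonicity inequality is
    closed under this limit. *)
Lemma boundary_monotone w B : nrm w = 1 ->
  (forall r : R, 0 <= r < 1 -> nrm (f (r%:C * w)) <= B) ->
  exists2 b, nrm b <= B &
    forall z, nrm z < 1 -> 0 <= re ((f z - b) * conjc (z - w)).
Proof.
move=> w1 fB; pose r n : R := 1 - n.+1%:R^-1.
have r01 n : 0 <= r n < 1.
  by rewrite /r subr_ge0 invf_le1// ler1n gtrBl invr_gt0 ltr0n.
have [b Hb] := complex_bolzano_weierstrass (fun n => fB _ (r01 n)).
exists b => [|z z1].
  apply/ler_addgt0Pr => e e0; have [n _ H] := Hb e 0%N e0.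
  apply: le_trans (ler_nrm_dist _ (f ((r n)%:C * w))) _.
  by rewrite nrmB; apply: lerD (fB _ (r01 n)) (ltW H).
apply: monotone_closed => e e0.
have [N _ HN] := near_infty_natSinv_lt (PosNum e0).
have [n Nn H] := Hb e N e0; exists (f ((r n)%:C * w)), ((r n)%:C * w);
  split => //.
  have -> : (r n)%:C * w - w = (- n.+1%:R^-1)%:C * w.
    by rewrite /r rmorphB rmorphN /=; ring.
  by rewrite Normc.normcM w1 mulr1 nrm_real normrN ger0_norm ?invr_ge0//;
    exact: HN.
apply: (monotone fF F_gt0) => //.
have /andP[r0 r1] := r01 n.
by rewrite Normc.normcM w1 mulr1 nrm_real ger0_norm.
Qed.

(* [|f - w|] attains its minimum over a small square inside the square, and the
   minimum vanishes because [f] moves in every direction where [F <> 0]. *)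
Lemma open_image : open (f @` [set z | nrm z < 1]).
Proof.
apply/open_complexP => _ [z0 /= z01 <-].
have [C C0 [e e0 He]] := fF z01.
have d0 : 0 < nrm (F z0).
  by apply: lt_le_trans (re_le_nrm _); exact: F_gt0.
move: (F z0) d0 He => d d0 He.
(* The three bounds keep the square within the range of the Taylor estimate, keep it inside the
   disk, and make the remainder at most half of the linear term. *)
pose x := Num.min (e / 3) (Num.min ((1 - nrm z0) / 3) (nrm d / (4 * (C + 1)))).
have x0 : 0 < x.
  rewrite /x !lt_min !divr_gt0// ?subr_gt0// ?mulr_gt0//; lra.
have xe : 2 * x < e.
  have : x <= e / 3 by rewrite /x ge_min lexx.
  by lra.
have xz : nrm z0 + 2 * x < 1.
  have : x <= (1 - nrm z0) / 3 by rewrite /x !ge_min lexx orbT.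
  by lra.
have xC : 4 * C * x <= nrm d.
  have : x <= nrm d / (4 * (C + 1)) by rewrite /x !ge_min lexx !orbT.
  rewrite ler_pdivlMr; last by rewrite mulr_gt0// ltr_wpDl.
  by nra.
pose Q : set (R * R) := `[- x, x] `*` `[- x, x].
pose p (t : R * R) := z0 + (t.1 +i* t.2).
have QE t : Q t = (`|t.1| <= x /\ `|t.2| <= x) :> Prop.
  by rewrite /Q /= !in_itv /= !ler_norml.
have nQ t : Q t -> nrm (t.1 +i* t.2) <= 2 * x.
  rewrite QE => -[t1 t2]; apply: le_trans (ler_nrm_reim _) _ => /=; lra.
have pQ t : Q t -> nrm (p t) < 1.
  by move=> /nQ Qt; apply: le_lt_trans (ler_nrmD _ _) _; lra.
have far t : Q t -> nrm d * nrm (t.1 +i* t.2) / 2 <= nrm (f (p t) - f z0).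
  move=> /nQ Qt; have := He _ (le_lt_trans Qt xe).
  rewrite -/(p t); move: (f (p t) - f z0) (t.1 +i* t.2) Qt => y h Qt H.
  have := ler_nrm_dist (d * h) y; rewrite nrmB Normc.normcM.
  have : C * nrm h ^+ 2 <= nrm d / 2 * nrm h.
    rewrite expr2 mulrA ler_wpM2r ?nrm_ge0//.
    by have := ler_wpM2l C0 Qt; lra.
  by lra.
exists (nrm d * x / 4); first by rewrite divr_gt0// mulr_gt0.
move=> w wz.
have pc t : p @ t --> p t.
  apply/cvg_complexP => eps eps0; have e20 : 0 < eps / 2 by rewrite divr_gt0.
  apply: filterS (nbhsx_ballx t _ e20).
  move=> [s1 s2] [/= H1 H2]; rewrite /p /=.
  apply: le_lt_trans (ler_nrm_reim _) _; rewrite !reimE /=.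
  rewrite (_ : re z0 + s1 - _ = s1 - t.1); last by ring.
  rewrite (_ : im z0 + s2 - _ = s2 - t.2); last by ring.
  by rewrite [eps]splitr ltrD// distrC.
have [|||t tQ tmin] := @compact_EVT_min _ R (fun t => nrm (f (p t) - w)) Q.
- by exists (0, 0); rewrite QE /= normr0 ltW.
- by apply: compact_setX; exact: segment_compact.
- apply: continuous_in_subspaceT => t;
    rewrite inE => /pQ/fF/qderiv_continuous ft.
  apply: cvg_nrm; exact: (cvgB (cvg_comp _ _ (pc t) ft) (cvg_cst _)).
rewrite inE in tQ.
have tw : nrm (f (p t) - w) < nrm d * x / 4.
  apply: le_lt_trans wz; rewrite nrmB.
  have := tmin (0, 0); rewrite /p /= addr0 nrmB [nrm (f z0 - w)]nrmB.
  by apply; rewrite inE QE /= normr0 ltW.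
(* The minimizer has room around it: at modulus [x] or more, [f] would be at distance at least |d| x
   / 2 from [f z0], too far from [w]. *)
have tx : nrm (t.1 +i* t.2) < x.
  have := far _ tQ.
  have := ler_nrm_dist (f (p t) - f z0) (f (p t) - w).
  rewrite (_ : f (p t) - f z0 - (f (p t) - w) = w - f z0) => [H1 H2|];
    last by ring.
  have {H1 H2} : nrm d * nrm (t.1 +i* t.2) / 2 < nrm d * x / 2 by lra.
  by rewrite -!mulrA !ltr_pM2l// ltr_pM2r.
exists (p t); first exact: pQ.
apply/eqP/negPn/negP; rewrite -subr_eq0 -nrm_gt0 => g0.
have pt1 := pQ _ tQ.
have [C' C'0 [e' e'0 He']] := fF pt1.
have d'0 : 0 < nrm (F (p t)).
  by apply: lt_le_trans (re_le_nrm _); exact: F_gt0.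
move: (F (p t)) d'0 He' => d' d'0 He'.
(* A damped Newton step: moving by [- (s%:C * k)] multiplies the defect [g] by [1 - s], up to a
   quadratic error. The bounds on [s] keep the step inside the square and the error at most s |g| /
   2, contradicting minimality. *)
pose g := f (p t) - w; pose k := g / d'.
have k0 : 0 < nrm k by rewrite Normc.normcM Normc.normcV divr_gt0.
pose s := Num.min 1 (Num.min (e' / (2 * nrm k))
  (Num.min ((x - nrm (t.1 +i* t.2)) / nrm k)
  (nrm g / (2 * (C' + 1) * nrm k ^+ 2)))).
have s0 : 0 < s.
  by rewrite /s !lt_min ltr01 !divr_gt0// ?subr_gt0// !mulr_gt0// ltr_wpDl.
have s1 : s <= 1 by rewrite /s ge_min lexx.
have se : s * nrm k < e'.
  have : s <= e' / (2 * nrm k) by rewrite /s !ge_min lexx !orbT.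
  by rewrite ler_pdivlMr ?mulr_gt0//; have := mulr_gt0 s0 k0; lra.
have sx : s * nrm k <= x - nrm (t.1 +i* t.2).
  have : s <= (x - nrm (t.1 +i* t.2)) / nrm k by rewrite /s !ge_min lexx !orbT.
  by rewrite ler_pdivlMr.
have sC : s * (2 * (C' + 1) * nrm k ^+ 2) <= nrm g.
  have : s <= nrm g / (2 * (C' + 1) * nrm k ^+ 2)
    by rewrite /s !ge_min lexx !orbT.
  by rewrite ler_pdivlMr// !mulr_gt0// ltr_wpDl.
pose h := - (s%:C * k).
have nh : nrm h = s * nrm k by rewrite normcN Normc.normcM nrm_real gtr0_norm.
pose t' := (t.1 + re h, t.2 + im h).
have E : t'.1 +i* t'.2 = (t.1 +i* t.2) + h.
  by rewrite /t' /=; move: (h) => [? ?].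
have pt' : p t' = p t + h by rewrite /p E addrA.
have Qt' : Q t'.
  have H : nrm (t'.1 +i* t'.2) <= x.
    by rewrite E; apply: le_trans (ler_nrmD _ _) _; rewrite nh; lra.
  by rewrite QE; split; [exact: le_trans (ler_re_nrm (_ +i* _)) H|
    exact: le_trans (ler_im_nrm (_ +i* _)) H].
have := tmin t'; rewrite inE => /(_ Qt'); apply/negP; rewrite -ltNge pt' -/g.
have := He' h; rewrite nh => /(_ se) H.
have dh : d' * h = - (s%:C * g).
  rewrite /h /k; field; apply/eqP => d'E; move: d'0; rewrite d'E.
  by rewrite Normc.normc0 ltxx.
have -> : f (p t + h) - w = (f (p t + h) - f (p t) - d' * h) + (1 - s)%:C * g.
  by rewrite dh rmorphB /= /g; ring.
apply: le_lt_trans (ler_nrmD _ _) _; rewrite Normc.normcM nrm_real.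
rewrite ger0_norm ?subr_ge0//.
have g0' : 0 < nrm g by [].
move: H; move: (nrm (_ - _ - _)) => y; move: sC; rewrite exprMn.
have := sqr_ge0 (nrm k); move: (nrm k ^+ 2) => K K0 sC H.
have H2 : C' * (s ^+ 2 * K) <= s * (nrm g / 2).
  rewrite (_ : C' * _ = s * (C' * s * K)); last by ring.
  by rewrite ler_pM2l//; have := mulr_ge0 (ltW s0) K0; nra.
have := mulr_gt0 s0 g0'; lra.
Qed.

End MonotoneMap.

(** * The two sides of a curve that is a graph over the real axis *)

Section Graph.
Variable R : realType.
Variable g : R -> R[i].
Hypothesis g_cont : forall r : R, 0 <= r < 1 -> g @ r --> g r.
Hypothesis g_mono : forall r s, 0 <= r -> r < s -> s < 1 -> re (g r) < re (g s).
Implicit Types (w : R[i]) (r s t : R).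

(* The points strictly above ([s = 1]) or below ([s = -1]) the curve [g]. *)
Definition graph_side s : set R[i] := [set w | exists r,
  [/\ 0 < r < 1, re w = re (g r) & 0 < s * (im w - im (g r))]].

Lemma graph_IVT r t (y : R) : 0 <= r -> r <= t -> t < 1 ->
  re (g r) < y < re (g t) -> exists2 s, r < s < t & re (g s) = y.
Proof.
move=> r0 rt t1 /andP[ry yt].
have [||s /itvP st E] := @IVT R (fun s => re (g s)) r t y rt.
- apply: continuous_in_subspaceT => s; rewrite inE /= in_itv /= => /andP[rs st].
  have /cvg_complexP H := g_cont (introT andP (conj (le_trans r0 rs)
    (le_lt_trans st t1))).
  apply/cvgrPdist_lt => e /H; apply: filterS => x; rewrite nrmB => {}H.
  by rewrite -reB; apply: le_lt_trans (ler_re_nrm _) H.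
- by rewrite (min_idPl _) ?(max_idPr _) ?(ltW ry) ?(ltW yt)//
    (ltW (lt_trans ry yt)).
exists s => //; rewrite !lt_neqAle !st !andbT.
by apply/andP; split; apply/eqP => sE; subst; rewrite ?E ltxx in ry yt.
Qed.

Lemma open_graph_side s : `|s| = 1 -> open (graph_side s).
Proof.
move=> s1; apply/open_complexP => w0 [r0 [/andP[r00 r01] wr m0]].
set m := s * _ in m0; have m20 : 0 < m / 2 by rewrite divr_gt0.
have /g_cont/cvg_complexP/(_ _ m20)/nbhs_ballP[d /= d0 dH] : 0 <= r0 < 1.
  by rewrite ltW.
(* Between [r0 - e] and [r0 + e] the curve moves by less than [m / 2], and by the intermediate value
   theorem it passes over every abscissa close to that of [w0]. *)
pose e := Num.min (d / 2) (Num.min (r0 / 2) ((1 - r0) / 2)).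
have e0 : 0 < e by rewrite /e !lt_min !divr_gt0// subr_gt0.
have [ed er er1] : [/\ e <= d / 2, e <= r0 / 2 & e <= (1 - r0) / 2].
  by rewrite /e !ge_min !lexx !orbT.
have a0 : re (g (r0 - e)) < re w0 by rewrite wr; apply: g_mono; lra.
have b0 : re w0 < re (g (r0 + e)) by rewrite wr; apply: g_mono; lra.
exists (Num.min (m / 2) (Num.min (re w0 - re (g (r0 - e)))
    (re (g (r0 + e)) - re w0))).
  by rewrite !lt_min m20 !subr_gt0 a0.
move=> w; rewrite !lt_min => /and3P[wm wa wb].
have := ler_re_nrm (w - w0); rewrite reB ler_norml => /andP[rw1 rw2].
have [||||r /andP[r1 r2] rE] := @graph_IVT (r0 - e) (r0 + e) (re w).
- by lra.
- by lra.
- by lra.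
- by apply/andP; split; lra.

exists r; split; [by apply/andP; split; lra|by []|].
have {}dH : nrm (g r - g r0) < m / 2.
  by apply: dH; rewrite /ball /= ltr_norml; apply/andP; split; lra.
have -> : s * (im w - im (g r)) = m + s * im (w - w0) - s * im (g r - g r0).
  by rewrite /m !imB; ring.
have aux z : nrm z < m / 2 -> `|s * im z| < m / 2.
  by move=> zm; rewrite normrM s1 mul1r; apply: le_lt_trans (ler_im_nrm _) zm.
have := aux _ wm; have := aux _ dH; rewrite !ltr_norml => /andP[? ?] /andP[? ?].
lra.
Qed.

Lemma graph_side_disjoint w : graph_side 1 w -> graph_side (-1) w -> False.
Proof.
move=> [r [/andP[r0 r1] rE wr]] [s [/andP[s0 s1] sE ws]].
have rs : r = s.
  case: (ltgtP r s) => // [rs|sr].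
    by have := g_mono (ltW r0) rs s1; rewrite -rE -sE ltxx.
  by have := g_mono (ltW s0) sr r1; rewrite -rE -sE ltxx.
by subst; lra.
Qed.

End Graph.

(** * Images of radii as graphs *)

Section RadialGraph.
Variable R : realType.
Variables f F : R[i] -> R[i].
Hypothesis fF : forall z, nrm z < 1 -> qderiv f z (F z).
Hypothesis F_gt0 : forall z, nrm z < 1 -> 0 < re (F z).
Variable u : R[i].
Hypothesis u1 : nrm u = 1.

(** The rotation by [conjc u] carries the axis spanned by [u] to the real axis, over which the image
    of the radius is a graph. *)
Definition radial (r : R) : R[i] := conjc u * f (r%:C * u).

Lemma nrm_radius (r : R) : 0 <= r < 1 -> nrm (r%:C * u) < 1.
Proof. by move=> /andP[r0 r1];
  rewrite Normc.normcM u1 mulr1 nrm_real ger0_norm. Qed.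

Lemma radial_cont (r : R) : 0 <= r < 1 -> radial @ r --> radial r.
Proof.
move=> /nrm_radius/fF/qderiv_continuous/cvg_complexP H.
apply/cvg_complexP => e /H /nbhs_complexP[d d0 {}H].
apply: filterS (nbhsx_ballx r d d0) => s; rewrite /ball /= => rs.
rewrite /radial -mulrBr Normc.normcM nrm_conj u1 mul1r; apply: H.
by rewrite -mulrBl -rmorphB Normc.normcM u1 mulr1 nrm_real distrC.
Qed.

Lemma radial_mono (r s : R) : 0 <= r -> r < s -> s < 1 ->
  re (radial r) < re (radial s).
Proof.
move=> r0 rs s1.
have := @strictly_monotone _ f F fF F_gt0 (s%:C * u) (r%:C * u).
rewrite !nrm_radius ?(ltW (le_lt_trans r0 rs)) ?r0 ?(lt_trans rs)//=.
move=> /(_ isT isT).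
have sr : (s - r)%:C * u != 0.
  by rewrite -nrm_gt0 Normc.normcM u1 mulr1 nrm_real normr_gt0 subr_eq0 gt_eqF.
rewrite -subr_eq0 -mulrBl -rmorphB sr => /(_ isT).
have -> : (f (s%:C * u) - f (r%:C * u)) * conjc ((s - r)%:C * u) =
    (s - r)%:C * (radial s - radial r).
  have -> : conjc ((s - r)%:C * u) = (s - r)%:C * conjc u.
    by case: (u) => a b; apply: complex_ext => /=; ring.
  by rewrite /radial; ring.
by rewrite reM /= mul0r subr0 pmulr_rgt0 ?subr_gt0// reB subr_gt0.
Qed.

Lemma radial_unbounded (c M : R) : 0 < c ->
  (forall r, 0 <= r < 1 -> c / (1 - r) <= re (F (r%:C * u))) ->
  exists2 r, 0 <= r < 1 & M < re (radial r).
Proof.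
(* Chosen so that [- (c * ln (1 - x))], the guaranteed growth up to the [x] below, exceeds
   [M - re (radial 0)]. *)
move=> c0 Fc; pose K := (`|M - re (radial 0)| + 1) / c.
have K0 : 0 < K by rewrite divr_gt0// ltr_wpDl.
pose x := 1 - expR (- K).
have x01 : 0 < x < 1.
  by rewrite /x subr_gt0 expR_lt1 oppr_lt0 K0 /= gtrBl expR_gt0.
have [x0 x1] := andP x01.
(* Comparison with - c log (1 - t): the lower bound on [F] makes the derivative [dh] nonnegative. *)
pose h (t : R) := re (radial t) + c * ln (1 - t).
pose dh (t : R) := re (F (t%:C * u)) - c / (1 - t).
have hd (t : R) : 0 <= t < 1 -> is_derive t 1 h (dh t).
  move=> t01; have [t0 t1] := andP t01.
  have t1' : 0 < 1 - t by rewrite subr_gt0.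
  have D1 : is_derive t 1 (fun s : R => re (radial s)) (re (F (t%:C * u))).
    have := @qderiv_line R f 0 (F (t%:C * u)) u (conjc u) t.
    rewrite add0r => /(_ (fF (nrm_radius t01))).
    rewrite mulrCA [conjc u * u]mulrC mul_conj u1 expr1n mulr1.
    by under eq_fun do rewrite add0r.
  have D2 : is_derive t 1 (fun s : R => ln (1 - s)) (- (1 - t)^-1).
    have D3 : is_derive (1 - t) 1 (@ln R) (1 - t)^-1 by exact: is_derive1_ln.
    have D4 : is_derive t 1 (fun s : R => 1 - s) (-1).
      have := is_deriveB (is_derive_cst (1 : R) t 1) (is_derive_id t 1).
      by rewrite sub0r.
    have := @is_derive1_comp R (@ln R) (fun s : R => 1 - s) t _ _ D3 D4.
    by rewrite mulrN1.
  have := is_deriveD D1 (is_deriveZ c D2).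
  by rewrite scalerN.
have [||t /itvP t0x E] := @MVT R h dh 0 x x0.
- move=> t /itvP t0x; apply: hd; rewrite t0x /=.
  by apply: lt_trans x1; rewrite t0x.
- apply: continuous_in_subspaceT => t; rewrite inE /= in_itv /= => /andP[t0 tx].
  apply/differentiable_continuous/derivable1_diffP.
  by case: (hd t) => //; rewrite t0 (le_lt_trans tx).
have H : 0 <= h x - h 0.
  rewrite E mulr_ge0 ?subr0 ?(ltW x0)// subr_ge0 Fc// t0x /=.
  by apply: lt_trans x1; rewrite t0x.
exists x; first by rewrite ltW.
move: H; rewrite /h subr0 ln1 mulr0 addr0 /x.
rewrite (_ : 1 - (1 - expR (- K)) = expR (- K)); last by ring.
rewrite expRK mulrN /K mulrCA divff ?gt_eqF// mulr1.
have := ler_norm (M - re (radial 0)); lra.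
Qed.

End RadialGraph.

(** * Boundaries in the sphere, and a criterion against local connectedness *)

Section Sphere.
Variable R : realType.
Implicit Types (z w : R[i]) (E : set R[i]).

Lemma sphere_dist_le z w : sphere_dist (Some z) (Some w) <= 2 * nrm (z - w).
Proof.
rewrite /sphere_dist ler_pdivrMr; last first.
  by rewrite mulr_gt0// sqrtr_gt0 ltr_pwDl// sqr_ge0.
rewrite ler_peMr ?mulr_ge0 ?nrm_ge0//.
have H (t : R[i]) : 1 <= Num.sqrt (1 + nrm t ^+ 2).
  by rewrite -{1}sqrtr1 ler_wsqrtr// lerDl sqr_ge0.
by have := ler_pM ler01 ler01 (H z) (H w); rewrite mulr1.
Qed.

Lemma sphere_dist_small z (e : R) : 0 < e -> exists2 d, 0 < d &
  forall p, sphere_dist (Some z) p < d -> exists2 w, p = Some w &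
    nrm (w - z) < e.
Proof.
move=> e0; pose N := Num.sqrt (1 + nrm z ^+ 2).
have N0 : 0 < N by rewrite sqrtr_gt0 ltr_pwDl// sqr_ge0.
have z0 : 0 < 1 + nrm z by rewrite ltr_wpDr ?nrm_ge0.
(* The first bound excludes infinity, at distance [2 / N], and forces |w - z| < 1 + |z|. The
   denominator of the metric is then controlled, and the second bound gives |w - z| < e. *)
exists (Num.min N^-1 (e / (N * (1 + nrm z)))).
  by rewrite lt_min invr_gt0 N0 divr_gt0// mulr_gt0.
move=> [w|] /=; rewrite -/N lt_min => /andP[H1 H2]; last first.
  by move: H1; rewrite -ltr_pdivlMr ?invr_gt0// invrK mulVf ?gt_eqF//; lra.
exists w => //; rewrite nrmB.
set W := Num.sqrt (1 + nrm w ^+ 2) in H1 H2.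
have W0 : 0 < W by rewrite sqrtr_gt0 ltr_pwDl// sqr_ge0.
have WE : W <= 1 + nrm z + nrm (z - w).
  have wE : nrm w <= nrm z + nrm (z - w) by rewrite nrmB; exact: ler_nrm_dist.
  apply: (@le_trans _ _ (1 + nrm w)); last by rewrite -addrA lerD2l.
  rewrite -(@ler_pXn2r _ 2)// ?nnegrE ?addr_ge0 ?nrm_ge0 ?(ltW W0)//.
  rewrite sqr_sqrtr ?addr_ge0 ?sqr_ge0// sqrrD expr1n mul1r.
  by rewrite lerD2r lerDl mulrn_wge0// nrm_ge0.
move: H1 H2; rewrite !ltr_pdivrMr ?mulr_gt0// mulKf ?gt_eqF// => H1 H2.
have E2 : e / (N * (1 + nrm z)) * (N * W) = e / (1 + nrm z) * W.
  by field; rewrite !gt_eqF.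
rewrite E2 in H2.
have {}H1 : nrm (z - w) < 1 + nrm z by lra.
have e1 : 0 < e / (1 + nrm z) by rewrite divr_gt0.
have : e / (1 + nrm z) * W <= e / (1 + nrm z) * (2 * (1 + nrm z)).
  by rewrite ler_pM2l//; lra.
rewrite mulrCA divfK ?gt_eqF//; lra.
Qed.

Lemma nbhs_sphereP z (U : set (riemann_sphere R)) :
  nbhs (to_sphere z) U <->
  exists2 e, 0 < e & forall w, nrm (w - z) < e -> U (to_sphere w).
Proof.
split.
  move=> /nbhs_ballP[e /= e0 eU]; exists (e / 2); first by rewrite divr_gt0.
  move=> w wz; apply: eU; rewrite ballEmdist /=.
  by apply: le_lt_trans (sphere_dist_le _ _) _; rewrite nrmB; lra.
move=> [e e0 eU]; have [d d0 dH] := sphere_dist_small z e0.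
apply/nbhs_ballP; exists d => //= p; rewrite ballEmdist /= => /dH[w -> wz].
exact: eU.
Qed.

Lemma open_to_sphere E : open E -> open (@to_sphere R @` E).
Proof.
move=> /open_complexP Eo; rewrite openE => _ [z Ez <-].
by apply/nbhs_sphereP; have [e e0 eE] := Eo z Ez; exists e => // w /eE;
  exists w.
Qed.

Lemma to_sphere_image E z : (@to_sphere R @` E) (to_sphere z) <-> E z.
Proof. by split=> [[w Ew [<-]]|Ez] //; exists z. Qed.

Lemma boundary_to_sphere E z : open E ->
  boundary (@to_sphere R @` E) (to_sphere z) <->
  (forall e, 0 < e -> exists2 w, E w & nrm (w - z) < e) /\ ~ E z.
Proof.
move=> /open_to_sphere Eo; rewrite /boundary (interior_id _).1//.
split=> [[cl nE]|[cl nE]].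
  split=> [e e0|/to_sphere_image//].
  have [|_ [[w Ew <-] H]] := cl (@to_sphere R @` [set w | nrm (w - z) < e]).
    by apply/nbhs_sphereP; exists e => // w wz; exists w.
  by exists w => //; move/to_sphere_image : H.
split=> [U /nbhs_sphereP[e e0 eU]|/to_sphere_image//].
have [w Ew wz] := cl e e0; exists (to_sphere w); split; last exact: eU.
by exists w.
Qed.

(** A small connected piece of the boundary around [z] would be separated by [P] and [Q]. Covering
    the complement of [E] is enough, since an open set misses its boundary. *)
Lemma not_locally_connected_boundary E z (e0 : R) : open E -> 0 < e0 ->
  boundary (@to_sphere R @` E) (to_sphere z) ->
  (forall e, 0 < e -> exists P Q : set R[i], [/\ open P /\ open Q,
    (forall w, P w -> Q w -> False),
    (forall w, nrm (w - z) < e0 -> ~ E w -> P w \/ Q w),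
    P z &
    exists w, [/\ Q w, nrm (w - z) < e &
      boundary (@to_sphere R @` E) (to_sphere w)]]) ->
  ~ locally_connected (boundary (@to_sphere R @` E)).
Proof.
move=> Eo e00 Az H /(_ _ Az (@to_sphere R @` [set w | nrm (w - z) < e0])).
case.
  by apply/nbhs_sphereP; exists e0 => // w wz; exists w.
move=> V [Vo Vz AV AVU].
have /nbhs_sphereP[e e_gt0 eV] : nbhs (to_sphere z) V by exact: open_nbhs_nbhs.
have [P [Q [[Po Qo] PQ cover Pz [a [Qa az Aa]]]]] := H e e_gt0.
set A := boundary _ in Az AV AVU Aa.
(* The trace of [P] is nonempty, relatively open, and relatively closed as the complement of the
   trace of [Q]. *)
have E1 : A `&` V `&` (@to_sphere R @` P) = A `&` V.
  apply: AV.
  - by exists (to_sphere z); split; [split|exists z].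
  - by exists (@to_sphere R @` P) => //; exact: open_to_sphere.
  exists (~` (@to_sphere R @` Q)); first exact/open_closedC/open_to_sphere.
  apply/seteqP; split=> p [AVp]; have [w /= wz wp] := AVU _ AVp; rewrite -wp.
    move=> /to_sphere_image Pw; split; first by rewrite wp.
    by move=> /to_sphere_image; exact: PQ.
  move=> nQ; split; first by rewrite wp.
  apply/to_sphere_image; have [Ap _] := AVp.
  have [//|/to_sphere_image//] : P w \/ Q w.
  apply: cover => //; rewrite -wp in Ap.
  by have /boundary_to_sphere[] := Ap.
have : (A `&` V) (to_sphere a) by split => //; exact: eV.
by rewrite -E1 => -[_ /to_sphere_image Pa]; exact: PQ Pa Qa.
Qed.

(** The first exit point, at the infimum of the parameters outside [E]: it is outside because [E] is
    open, and all earlier points are inside. *)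
Lemma segment_boundary E z w : open E -> E z -> ~ E (z + w) ->
  exists t : R, [/\ 0 < t <= 1, ~ E (z + t%:C * w) &
    forall e, 0 < e -> exists2 y, E y & nrm (y - (z + t%:C * w)) < e].
Proof.
move=> /open_complexP Eo Ez nEw.
pose B : set R := [set t | 0 <= t <= 1 /\ ~ E (z + t%:C * w)].
have B1 : B 1 by split; [rewrite ler01 lexx|rewrite mul1r].
have Bl : lbound B 0 by move=> t [/andP[]].
have Bi : has_inf B by split; [exists 1|exists 0].
have near_t (t e : R) : 0 < e -> exists2 d : R, 0 < d &
    forall s : R, `|s - t| < d -> nrm (z + s%:C * w - (z + t%:C * w)) < e.
  move=> e0; have w0 : 0 < nrm w + 1 by rewrite ltr_wpDl ?nrm_ge0.
  exists (e / (nrm w + 1)) => [|s]; first by rewrite divr_gt0.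
  rewrite ltr_pdivlMr// => st.
  rewrite (_ : _ - _ = (s - t)%:C * w); last by rewrite rmorphB /=; ring.
  rewrite Normc.normcM nrm_real; apply: le_lt_trans st.
  by rewrite ler_wpM2l// lerDl.
have t0 : 0 <= inf B by apply: lb_le_inf => //; exists 1.
have t1 : inf B <= 1 by exact: (ge_inf Bi.2 B1).
have nEt : ~ E (z + (inf B)%:C * w).
  move=> /Eo[e e0 eE]; have [d d0 dH] := near_t (inf B) e e0.
  have [t Bt tB] := inf_adherent d0 Bi; case: (Bt) => _; apply; apply/eE/dH.
  have Bt' : inf B <= t by exact: (ge_inf Bi.2 Bt).
  by rewrite ger0_norm ?subr_ge0// ltrBlDl.
have tpos : 0 < inf B.
  rewrite lt_neqAle t0 andbT eq_sym; apply/eqP => B0.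
  by apply: nEt; rewrite B0 mul0r addr0.
exists (inf B); split=> // [|e e0]; first by rewrite tpos t1.
have [d d0 dH] := near_t (inf B) e e0.
pose s := Num.max 0 (inf B - d / 2).
have sB : s < inf B by rewrite gt_max tpos/=; lra.
have s0 : 0 <= s by rewrite le_max lexx.
exists (z + s%:C * w).
  apply: contrapT => nEs; have : inf B <= s.
    by apply: (ge_inf Bi.2); split; rewrite ?s0 ?(le_trans (ltW sB)).
  by rewrite leNgt sB.
apply: dH; rewrite distrC ger0_norm ?subr_ge0 ?(ltW sB)//.
have : inf B - d / 2 <= s by rewrite le_max lexx orbT.
by lra.
Qed.

End Sphere.

(* Since the radial curve lies in the image, the complement of the image has no
   point on it: near [x] the two sides partition this complement. *)
Definition radial_splitting (R : realType) (f : R[i] -> R[i]) (u x : R[i])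
    (e : R) :=
  let E := f @` [set z | nrm z < 1] in
  let side s w := graph_side (radial f u) s (conjc u * w) in
  [/\ forall w, nrm (w - x) < 1 -> ~ E w -> side (-1) w \/ side 1 w,
      side (-1) x,
      exists2 w, E w & nrm (w - x) < e &
      exists w, [/\ side 1 w, nrm (w - x) < e, ~ E w &
        forall d, 0 < d -> exists2 y, E y & nrm (y - w) < d]].

(** * A radial image squeezed between two rays that miss the image *)

Section Crossing.
Variable R : realType.
Variables f F : R[i] -> R[i].
Hypothesis fF : forall z, nrm z < 1 -> qderiv f z (F z).
Hypothesis F_gt0 : forall z, nrm z < 1 -> 0 < re (F z).
Hypothesis f0 : f 0 = 0.
Local Notation E := (f @` [set z | nrm z < 1]).
Implicit Types (z w u v a b : R[i]) (s t e : R).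

(** If [f z] were on the ray, the inequality would read t (Re (v conj z) - 1) >= 0, impossible since
    |v conj z| < 1. *)
Lemma ray_disjoint b v t : nrm v = 1 ->
  (forall z, nrm z < 1 -> 0 <= re ((f z - b) * conjc (z - v))) ->
  0 < t -> ~ E (b + t%:C * v).
Proof.
move=> v1 K t0 [z /= z1 fz]; have := K z z1.
rewrite fz [b + _]addrC addrK -mulrA.
have -> : v * conjc (z - v) = v * conjc z - 1.
  have := mul_conj v; rewrite v1 expr1n => vv.
  by rewrite rmorphB mulrBr vv.
rewrite reM mul0r subr0 pmulr_rge0// reB /= subr_ge0; apply/negP;
  rewrite -ltNge.
apply: le_lt_trans (re_le_nrm _) _.
by rewrite Normc.normcM v1 mul1r nrm_conj.
Qed.

Lemma open_rotation u (S : set R[i]) : nrm u = 1 -> open S ->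
  open [set w | S (conjc u * w)].
Proof.
move=> u1 /open_complexP So; apply/open_complexP => w /= /So[e e0 eS].
exists e => // w' ww; apply: eS.
by rewrite -mulrBr Normc.normcM nrm_conj u1 mul1r.
Qed.

(** On the normal x + t i u through [x = a + 10], the curve passes at a height [s] with 0 < s < s1,
    where [s1] is the height of the ray from [b]. So [x] is below the curve, and the normal leaves
    the image above it, within 13 e of [x]. *)
Lemma radial_crossing a b u v e :
  nrm a <= 7 -> nrm u = 1 -> nrm v = 1 ->
  (forall z, nrm z < 1 -> 0 <= re ((f z - a) * conjc (z - 1))) ->
  (forall z, nrm z < 1 -> 0 <= re ((f z - b) * conjc (z - v))) ->
  (forall M, exists2 r, 0 <= r < 1 & M < re (radial f u r)) ->
  0 < im u -> im (u * conjc v) < 0 -> 0 < e <= 20^-1 ->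
  nrm (u - 1) <= e -> nrm (v - 1) <= e -> nrm (b - a) <= e ->
  radial_splitting f u (a + 10) (13 * e).
Proof.
move=> a7 u1 v1 Ka Kb unb imu imuv /andP[e0 e20] ue ve be.
have uu : conjc u * u = 1.
  by have := mul_conj u; rewrite u1 expr1n mulrC.
have vv : v * conjc v = 1.
  by have := mul_conj v; rewrite v1 expr1n.
have re10 : re (10 : R[i]) = 10 by rewrite complex_nat.
have im10 : im (10 : R[i]) = 0 by rewrite complex_nat.
(* The shift 10 beats |a| <= 7 and the radius 1, leaving real part at least 2; as |w| <= 18,
   rotating by [conjc u] changes it by at most 18/20. *)
have re_pos w : nrm (w - (a + 10)) < 1 -> 0 < re (conjc u * w).
  move=> w1; have ra : - re a <= 7.
    by rewrite -reN; apply: le_trans (re_le_nrm _) _; rewrite normcN.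
  have rw : 2 <= re w.
    have : - re (w - (a + 10)) <= 1.
      by rewrite -reN; apply: le_trans (re_le_nrm _) _; rewrite normcN ltW.
    by rewrite reB reD re10; lra.
  have w18 : nrm w <= 18.
    apply: le_trans (ler_nrm_dist _ (a + 10)) _.
    have := ler_nrmD a 10; rewrite nrm_nat; lra.
  have -> : conjc u * w = w + conjc (u - 1) * w.
    by rewrite conjc_sub1; ring.
  have : nrm (conjc (u - 1) * w) <= 20^-1 * 18.
    by rewrite Normc.normcM nrm_conj ler_pM ?nrm_ge0// (le_trans ue).
  have : - re (conjc (u - 1) * w) <= nrm (conjc (u - 1) * w).
    by rewrite -reN -normcN re_le_nrm.
  by rewrite reD; lra.
have radial0 : re (radial f u 0) = 0 by rewrite /radial mul0r f0 mulr0.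
have hit w : nrm (w - (a + 10)) < 1 ->
    exists2 r, 0 < r < 1 & re (radial f u r) = re (conjc u * w).
  move=> /re_pos w0; have [t /andP[t0 t1] wt] := unb (re (conjc u * w)).
  have [||||r /andP[r0 rt] rE] :=
    @graph_IVT _ (radial f u) (radial_cont fF u1) 0 t (re (conjc u * w)).
  - by [].
  - by [].
  - by [].
  - by rewrite radial0 w0.
  by exists r => //; rewrite r0 (lt_trans rt).
have radialE r : u * radial f u r = f (r%:C * u).
  by rewrite /radial mulrA [u * _]mulrC uu mul1r.
have inE r : 0 < r < 1 -> nrm (r%:C * u) < 1.
  by move=> /andP[r0 r1]; apply: nrm_radius; rewrite ?ltW.
pose x := a + 10.
have [|r r01 rx] := hit x; first by rewrite subrr Normc.normc0.
have [r0 r1] := andP r01.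
pose s := im (radial f u r) - im (conjc u * x).
have fr : f (r%:C * u) = x + s%:C * ('i * u).
  rewrite -radialE.
  have -> : radial f u r = conjc u * x + s%:C * 'i.
    by apply: complex_ext; rewrite ?reD ?imD ?rx /s ?reM ?imM /=; ring.
  by rewrite mulrDr mulrA [u * conjc u]mulrC uu mul1r; ring.
(* At the crossing point the inequality for [a] reads 10 Re (r u - 1) + s Im u >= 0, with negative
   first term and Im u > 0. *)
have s0 : 0 < s.
  have := Ka _ (inE r r01); rewrite fr.
  have -> : (x + s%:C * ('i * u) - a) * conjc (r%:C * u - 1) =
      10 * conjc (r%:C * u - 1) + s%:C * ('i * (r%:C * (conjc u * u)) - 'i * u).
    by rewrite /x conjc_sub1 conjc_scale; ring.
  rewrite uu mulr1.
  have -> : re (10 * conjc (r%:C * u - 1) + s%:C * ('i * r%:C - 'i * u)) =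
      10 * re (r%:C * u - 1) + s * im u.
    have -> : 10 = (10 : R)%:C :> R[i] by exact: complex_nat.
    by case: (u) => c d /=; ring.
  have : re (r%:C * u - 1) < 0.
    by rewrite reB subr_lt0; apply: le_lt_trans (re_le_nrm _) (inE r r01).
  by move: imu; move: (re _) (im u) => A I I0 A0 H;
    rewrite -(pmulr_lgt0 _ I0); lra.
(* Coordinates in which the ray from [b] is the positive real axis: [X] is close to 10, and the
   normal has direction i W with [W] close to 1. *)
pose W := u * conjc v; pose X := conjc v * (x - b).
have nX : nrm (X - 10) <= 11 * e.
  have -> : X - 10 = conjc v * (a - b) + 10 * conjc (v - 1).
    by rewrite /X /x conjc_sub1; ring.
  apply: le_trans (ler_nrmD _ _) _.
  rewrite !Normc.normcM !nrm_conj v1 nrm_nat mul1r nrmB; lra.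
have nW : nrm (W - 1) <= 2 * e.
  have -> : W - 1 = conjc v * ((u - 1) - (v - 1)) by rewrite /W -vv; ring.
  rewrite Normc.normcM nrm_conj v1 mul1r.
  by apply: le_trans (ler_nrmB _ _) _; lra.
have reX : 0 < re X.
  have := le_trans (ler_re_nrm (X - 10)) nX.
  by rewrite reB re10 ler_norml => /andP[? ?]; lra.
have imX : - im X <= 11 * e.
  have := le_trans (ler_im_nrm (X - 10)) nX.
  by rewrite imB im10 subr0 ler_norml => /andP[? ?]; lra.
have reW : 9 / 10 <= re W.
  have := le_trans (ler_re_nrm (W - 1)) nW.
  by rewrite reB ler_norml /= => /andP[? ?]; lra.
have reW0 : 0 < re W by lra.
have imW : im W < 0 by [].
(* The height where the normal meets the real axis of these coordinates; 13 is enough because 13 *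
   9/10 > 11. *)
pose s1 := - im X / re W.
have s1e : s1 < 13 * e.
  rewrite /s1 ltr_pdivrMr//; apply: le_lt_trans imX _.
  have := ler_wpM2l (ltW e0) reW; lra.
have xE t : x + t%:C * ('i * u) - b = v * (X + t%:C * ('i * W)).
  rewrite /X /W mulrDr mulrA vv mul1r.
  rewrite (_ :
    v * (t%:C * ('i * (u * conjc v))) = t%:C * ('i * u) * (v * conjc v)).
    by rewrite vv mulr1; ring.
  by ring.
have reXW t : re (X + t%:C * ('i * W)) = re X - t * im W.
  by case: (X) (W) => ? ? [? ?] /=; ring.
have imXW t : im (X + t%:C * ('i * W)) = im X + t * re W.
  by case: (X) (W) => ? ? [? ?] /=; ring.
(* In the inequality for [b], X + s i W has positive real part while r W - 1 has negative real and
   imaginary parts, so the imaginary part of X + s i W must be negative. *)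
have ss1 : s < s1.
  rewrite /s1 ltr_pdivlMr//.
  suff : im (X + s%:C * ('i * W)) < 0 by rewrite imXW; lra.
  have := Kb _ (inE r r01); rewrite fr xE.
  have -> : conjc (r%:C * u - v) = conjc v * conjc (r%:C * W - 1).
    have vW : u = v * W by rewrite /W mulrCA vv mulr1.
    by rewrite -conjcM {1}vW; congr conjc; ring.
  rewrite (_ :
    v * _ * _ = v * conjc v * ((X + s%:C * ('i * W)) * conjc (r%:C * W - 1))).
    rewrite vv mul1r.
    have : 0 < re (X + s%:C * ('i * W)).
      by rewrite reXW; have := mulr_gt0 s0 (_ : 0 < - im W);
        rewrite oppr_gt0 => /(_ imW); lra.
    have : re (r%:C * W - 1) < 0.
      rewrite reB subr_lt0; apply: le_lt_trans (re_le_nrm _) _.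
      by rewrite !Normc.normcM nrm_conj u1 v1 !mulr1 nrm_real gtr0_norm.
    have : im (r%:C * W - 1) < 0.
      by rewrite imB subr0 imM mul0r addr0 /= pmulr_rlt0.
    move: (X + _) (_ - 1) => [A B] [C D] /= D0 C0 A0.
    rewrite mulrN opprK => H; rewrite ltNge; apply/negP => B0.
    have := mulr_ge0 B0 (_ : 0 <= - D); rewrite oppr_ge0 (ltW D0) => /(_ isT).
    have := mulr_gt0 A0 (_ : 0 < - C); rewrite oppr_gt0 C0 => /(_ isT).
    lra.
  by ring.
have nEy : ~ E (x + s1%:C * ('i * u)).
  have -> : x + s1%:C * ('i * u) = b + (re X - s1 * im W)%:C * v.
    apply/eqP; rewrite -subr_eq0; apply/eqP.
    rewrite opprD addrA xE [_%:C * v]mulrC -mulrBr.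
    rewrite (_ : X + _ - _ = 0) ?mulr0//.
    apply: complex_ext; rewrite ?reB ?imB ?reXW ?imXW /= ?subrr// subr0.
    by rewrite /s1 mulfVK ?subrr ?gt_eqF// addrC addNr.
  apply: (ray_disjoint v1 Kb).
  have s10 : 0 < s1 := lt_trans s0 ss1.
  by have := mulr_gt0 s10 (_ : 0 < - im W); rewrite oppr_gt0 => /(_ imW); lra.
have side t : re (conjc u * (x + t%:C * ('i * u))) = re (radial f u r) /\
    im (conjc u * (x + t%:C * ('i * u))) - im (radial f u r) = t - s.
  have -> : conjc u * (x + t%:C * ('i * u)) =
    conjc u * x + t%:C * 'i * (conjc u * u) by ring.
  by rewrite uu mulr1 rx /s !reD !imD reM imM /=; split; ring.
have nrm_side t : nrm (x + t%:C * ('i * u) - x) = `|t|.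
  have -> : x + t%:C * ('i * u) - x = t%:C * ('i * u) by ring.
  rewrite !Normc.normcM u1 mulr1 nrm_real nrmE /= expr0n expr1n add0r sqrtr1.
  by rewrite mulr1.
split.
- move=> w /hit[t t01 tw] nEw.
  case: (ltgtP (im (conjc u * w)) (im (radial f u t))) => [lt_wt|lt_tw|eq_tw].
  + by left; exists t; split => //; rewrite mulN1r opprB subr_gt0.
  + by right; exists t; split => //; rewrite mul1r subr_gt0.
  case: nEw; exists (t%:C * u); first exact: inE.
  rewrite -radialE (_ : radial f u t = conjc u * w); last exact: complex_ext.
  by rewrite mulrA [u * _]mulrC uu mul1r.
- exists r; have [] := side 0; rewrite mul0r addr0 => rE iE; split => //.
  by rewrite iE sub0r mulN1r opprK.
- exists (f (r%:C * u)); first by exists (r%:C * u) => //; exact: inE.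
  by rewrite fr nrm_side gtr0_norm// (lt_trans ss1).
(* From the curve, inside the image, up to the ray, outside it: the first exit point is a boundary
   point strictly above the curve. *)
have [||t [/andP[t0 t1] nEt cl]] :=
  @segment_boundary _ E (f (r%:C * u)) ((s1 - s)%:C * ('i * u))
    (open_image fF F_gt0).
- by exists (r%:C * u) => //; exact: inE.
- by rewrite fr -addrA -mulrDl -rmorphD (addrC s) subrK.
have tE : f (r%:C * u) + t%:C * ((s1 - s)%:C * ('i * u)) =
    x + (s + t * (s1 - s))%:C * ('i * u).
  rewrite fr (_ : (s + t * (s1 - s))%:C = s%:C + t%:C * (s1 - s)%:C); first
    by ring.
  by apply: complex_ext => /=; ring.
rewrite tE in nEt cl.
have ds : 0 < s1 - s by rewrite subr_gt0.
have ts0 : 0 < t * (s1 - s) by rewrite mulr_gt0.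
have ts1 : t * (s1 - s) <= s1 - s by rewrite ler_piMl// ltW.
exists (x + (s + t * (s1 - s))%:C * ('i * u)); split => //.
  exists r; have [rE iE] := side (s + t * (s1 - s)); split => //.
  by rewrite iE mul1r addrC addKr.
rewrite nrm_side gtr0_norm; last by rewrite addr_gt0.
lra.
Qed.

End Crossing.

(** * Convergence of poles and gaps to 1 *)

Section PoleLimits.
Variable R : realType.

Lemma cayley_near1 (t : R) : 0 <= t -> nrm (cayley t - 1) <= 2 * t.
Proof.
move=> t0; have d0 : 0 < 1 + t ^+ 2 by rewrite ltr_pwDl// sqr_ge0.
rewrite -(@ler_pXn2r _ 2)// ?nnegrE ?nrm_ge0 ?mulr_ge0// nrm_sqr reB imB /=.
have -> :
  ((1 - t ^+ 2) / (1 + t ^+ 2) - 1) ^+ 2 + (2 * t / (1 + t ^+ 2) - 0) ^+ 2 =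
    (2 * t) ^+ 2 / (1 + t ^+ 2) by field; rewrite gt_eqF.
by rewrite ler_pdivrMr// ler_peMr ?sqr_ge0// lerDl sqr_ge0.
Qed.

Lemma pole_param_small (e : R) : 0 < e ->
  exists N, forall n, (N <= n)%N -> pole_param R n < e.
Proof.
move=> e0; have := @cvg_expr R 4^-1.
rewrite ger0_norm ?invr_ge0// invf_lt1// ltr1n => /(_ isT).
move=> /cvgrPdist_lt/(_ _ e0)[N _ HN]; exists N => n /HN /=.
by rewrite sub0r normrN ger0_norm// ltW// pole_param_gt0.
Qed.

End PoleLimits.

(** * Failure of local connectedness at the point [a + 10] of the limit ray *)

Theorem theorem3p4 (R : realType) :
  exists f : R[i] -> R[i],
    noshiro_warschawski f /\
    ~ locally_connected (boundary (@to_sphere R @` (f @` @unit_disk R))).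
Proof.
have log_sumD := @qderiv_log_sum R; have log_sum'_gt0 := @re_log_sum'_gt0 R.
have diskE : @unit_disk R = [set z | nrm z < 1].
  by apply/funext => z; exact: unit_diskE.
have nrm0 : nrm (0 : R[i]) < 1 by rewrite Normc.normc0.
exists (@log_sum R); split.
  split; rewrite ?log_sum0//.
  - by move=> z; rewrite unit_diskE => /log_sumD/qderiv_derive1[].
  - by have [_ ->] := qderiv_derive1 (log_sumD _ nrm0); exact: log_sum'0.
  move=> z; rewrite unit_diskE => z1.
  by have [_ ->] := qderiv_derive1 (log_sumD _ z1); exact: log_sum'_gt0.
rewrite diskE.
have /choice[b Hb] (j : nat) : exists b : R[i], nrm b <= 7 /\
    forall z, nrm z < 1 -> 0 <= re ((log_sum z - b) * conjc (z - gap R j)).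
  have [b ? ?] := boundary_monotone log_sumD log_sum'_gt0 (nrm_gap R j)
    (nrm_log_sum_gap_le j).
  by exists b.
(* The gaps tend to 1, so a cluster point of the origins [b j] of their rays is the origin of the
   limit ray, of direction 1. *)
have [a Ha] := complex_bolzano_weierstrass (fun j => (Hb j).1).
have approx e : 0 < e -> exists j, pole_param R j < e /\ nrm (b j - a) < e.
  move=> e0; have [N HN] := pole_param_small e0.
  by have [j Nj ja] := Ha e N e0; exists j; split => //; exact: HN.
have gap1 j e : pole_param R j < e -> nrm (gap R j - 1) <= e.
  move=> pe; apply: le_trans (cayley_near1 (ltW (gap_param_gt0 R j))) _.
  by rewrite /gap_param; lra.
have pole1 j e : pole_param R j < e -> nrm (pole R j.+1 - 1) <= e.
  move=> pe; apply: le_trans (cayley_near1 (ltW (pole_param_gt0 R j.+1))) _.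
  by rewrite pole_paramS; have := pole_param_gt0 R j; lra.
have a7 : nrm a <= 7.
  apply/ler_addgt0Pr => e /approx[j [_ ja]].
  apply: le_trans (ler_nrm_dist _ (b j)) _.
  by rewrite nrmB; apply: lerD (Hb j).1 (ltW ja).
have Ka z : nrm z < 1 -> 0 <= re ((log_sum z - a) * conjc (z - 1)).
  move=> z1; apply: monotone_closed => e e0.
  have [|j [pj ja]] := approx (e / 2); first by rewrite divr_gt0.
  exists (b j), (gap R j); split; last exact: (Hb j).2.
    by lra.
  by have := gap1 _ _ pj; lra.
pose E := @log_sum R @` [set z : R[i] | nrm z < 1].
have Eo : open E := open_image log_sumD log_sum'_gt0.
(* The pole following gap [j] is used: its parameter is half that of the gap, so it lies between 1
   and the gap, and its curve between the limit ray and the ray of that gap. *)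
have cross e : 0 < e <= 20^-1 ->
    exists j, radial_splitting (@log_sum R) (pole R j) (a + 10) (13 * e).
  move=> /andP[e0 e20]; have [j [pj ja]] := approx e e0; exists j.+1.
  have p0 := pole_param_gt0 R j.+1.
  apply: (radial_crossing log_sumD log_sum'_gt0 (log_sum0 R) a7 (nrm_pole R _)
    (nrm_gap R j) Ka (Hb j).2).
  - move=> M; apply:
      (radial_unbounded log_sumD (nrm_pole R j.+1) M (weight_gt0 R j.+1)).
    by move=> r; exact: re_log_sum'_pole_ge.
  - by rewrite /= divr_gt0 ?mulr_gt0// ltr_pwDl// sqr_ge0.
  - apply: im_cayley_conj; first exact: ltW.
    by rewrite pole_paramS /gap_param; have := pole_param_gt0 R j; lra.
  - by rewrite e0.
  - exact: pole1.
  - exact: gap1.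
  - exact: ltW.
have small (e : R) : 0 < e -> exists2 e' : R, 0 < e' <= 20^-1 & 13 * e' <= e.
  move=> e0; exists (Num.min 20^-1 (e / 13)).
    by rewrite lt_min invr_gt0 ltr0n divr_gt0//= ge_min lexx.
  by rewrite mulrC -ler_pdivlMr// ge_min lexx orbT.
apply: (@not_locally_connected_boundary _ E (a + 10) 1 Eo) => //.
  apply/boundary_to_sphere => //; split=> [e e0|].
    have [e' /cross[j [_ _ [w Ew we] _]] ee] := small e e0.
    by exists w => //; apply: lt_le_trans ee.
  rewrite (_ : a + 10 = a + (10 : R)%:C * 1); last
    by rewrite mulr1 -complex_nat.
  exact: (ray_disjoint (Normc.normc1 R) Ka).
move=> e e0; have [e' /cross[j [cover below _ [w [above we nEw cl]]]] ee] :=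
  small e e0.
have u1 := nrm_pole R j.
(* The separating open sets are the sides of the curve: [a + 10] is below it, the nearby boundary
   point [w] above. *)
exists [set w | graph_side (radial (@log_sum R) (pole R j)) (-1)
  (conjc (pole R j) * w)].
exists [set w | graph_side (radial (@log_sum R) (pole R j)) 1
  (conjc (pole R j) * w)].
split => //.
- split; apply: open_rotation => //; apply: open_graph_side;
    rewrite ?normrN ?normr1//.
  + by move=> r; exact: (radial_cont log_sumD u1).
  + by move=> r s; exact: (radial_mono log_sumD log_sum'_gt0 u1).
  + by move=> r; exact: (radial_cont log_sumD u1).
  + by move=> r s; exact: (radial_mono log_sumD log_sum'_gt0 u1).
- move=> y /= yb ya; apply: (graph_side_disjoint _ ya yb).
  by move=> r s; exact: (radial_mono log_sumD log_sum'_gt0 u1).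
exists w; split => //; first exact: lt_le_trans ee.
exact/boundary_to_sphere.
Qed.
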